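(* Let $\alpha,L>0$, let $w_0\in\mathcal{Z}$, let $g:\mathcal{Z}\to\mathcal{Z}^*$ be a (continuous) monotone operator, let $\tilde g_z$ be a $(z,L)$-centered stochastic gradient estimator for $g$ for every $z\in\mathcal{Z}$, and let $z_\alpha=\mathrm{Prox}_{w_0}^\alpha(g)$. Let $\eta=\frac{\alpha}{8L^2}$, let $T$ be an integer with $T\ge\frac{4}{\eta\alpha}=\frac{32L^2}{\alpha^2}$, and let $N\in\mathbb{N}$. Then the output $\hat w_N$ of the restarted stochastic mirror descent algorithm described in the context satisfies $$\mathbb{E}\,V_{\hat w_N}(z_\alpha)\le2^{-N}V_{w_0}(z_\alpha).$$
   Context: Setup: $\mathcal{Z}=\mathcal{X}\times\mathcal{Y}$ with $\mathcal{X}\subset\mathbb{R}^n$, $\mathcal{Y}\subset\mathbb{R}^m$ convex and compact; $\|\cdot\|$ is a norm, with dual norm $\|\zeta\|_*=\max_{\|z\|\le1}\langle\zeta,z\rangle$. The distance generating function $r:\mathcal{Z}\to\mathbb{R}$ is $1$-strongly convex: $r(z')\ge r(z)+\langle\nabla r(z),z'-z\rangle+\frac12\|z'-z\|^2$ for all $z,z'\in\mathcal{Z}$ (for non-differentiable $r$, $\langle\nabla r(z),w\rangle:=\sup_{\gamma\in\partial r(z)}\langle\gamma,w\rangle$), and $\max r-\min r$ is finite. The Bregman divergence is $V_z(z')=r(z')-r(z)-\langle\nabla r(z),z'-z\rangle\ge\frac12\|z'-z\|^2$; it satisfies $-\langle\nabla V_z(z'),z'-u\rangle=V_z(u)-V_{z'}(u)-V_z(z')$.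 $g$ is monotone if $\langle g(z')-g(z),z'-z\rangle\ge0$ for all $z,z'$. $\mathrm{Prox}_z^\alpha(g)$ is the unique $z_\alpha\in\mathcal{Z}$ with $\langle g(z_\alpha)+\alpha\nabla V_z(z_\alpha),z_\alpha-u\rangle\le0$ for all $u\in\mathcal{Z}$; equivalently $\langle g(z_\alpha),z_\alpha-u\rangle\le\alpha V_z(u)-\alpha V_{z_\alpha}(u)-\alpha V_z(z_\alpha)$ for all $u\in\mathcal{Z}$. A stochastic estimator $\tilde g_{z_0}:\mathcal{Z}\to\mathcal{Z}^*$ is $(z_0,L)$-centered for $g$ if for all $z\in\mathcal{Z}$: (1) $\mathbb{E}[\tilde g_{z_0}(z)]=g(z)$; (2) $\mathbb{E}\|\tilde g_{z_0}(z)-g(z_0)\|_*^2\le L^2\|z-z_0\|^2$. Each evaluation uses fresh randomness, independent of everything before. Algorithm (parameters $\eta,T,N$): set $\hat w_0=w_0$. For each phase $\nu=1,\dots,N$: draw $\hat T$ uniformly from $\{1,\dots,T\}$ (independently); set $w_0^{(\nu)}=\hat w_{\nu-1}$; for $t=1,\dots,\hat T$ set $$w_t^{(\nu)}=\operatorname*{arg\,min}_{w\in\mathcal{Z}}\Big\{\big\langle\tilde g_{\hat w_{\nu-1}}(w_{t-1}^{(\nu)}),w\big\rangle+\alpha V_{w_0}(w)+\tfrac1\eta V_{w_{t-1}^{(\nu)}}(w)\Big\}$$ (the regularization center $w_0$ is always the original initial point); set $\hat w_\nu=w_{\hat T}^{(\nu)}$. Output $\hat w_N$. *)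

(* Defs.v *)
(* Library: MathComp-Analysis *)
From HB Require Import structures.
From mathcomp Require Import all_boot all_order all_algebra.
From mathcomp Require Import all_classical all_reals all_analysis.

Set Implicit Arguments.
Unset Strict Implicit.
Unset Printing Implicit Defensive.

Import Order.TTheory GRing.Theory Num.Theory.
Import numFieldNormedType.Exports.

Local Open Scope classical_set_scope.
Local Open Scope ring_scope.

Definition dot (R : realType) (k : nat) (u v : 'rV[R]_k) : R :=
  \sum_(i < k) u ord0 i * v ord0 i.

(* R^n x R^m is identified with R^(n+m). *)
Definition prod_domain (R : realType) (n m : nat)
    (X : set 'rV[R]_n) (Y : set 'rV[R]_m) : set 'rV[R]_(n + m) :=
  [set z | X (lsubmx z) /\ Y (rsubmx z)].

Definition is_norm (R : realType) (k : nat) (nrm : 'rV[R]_k -> R) : Prop :=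
  [/\ forall u v, nrm (u + v) <= nrm u + nrm v,
      forall a u, nrm (a *: u) = `|a| * nrm u &
      forall u, nrm u = 0 -> u = 0].

(* The supremum is a maximum, the unit ball of a norm on R^k being compact. *)
Definition dual_norm (R : realType) (k : nat) (nrm : 'rV[R]_k -> R)
    (zeta : 'rV[R]_k) : R :=
  sup [set dot zeta z | z in [set z | nrm z <= 1]].

(* 'rV[R]_k with its Borel sigma-algebra *)
Definition borel (R : realType) (k : nat) :=
  g_sigma_algebraType (@open 'rV[R]_k).

Section distance_generating_function.
Context (R : realType) (k : nat).
Notation E := 'rV[R]_k.
Variables (Z : set E) (r : E -> R).

(* Values of [r] outside [Z] are irrelevant. *)
Definition subdifferential (z : E) : set E :=
  [set gamma | forall z', Z z' -> r z + dot gamma (z' - z) <= r z'].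

(* <nabla r(z), w>.  When r is differentiable at z this is the usual pairing
   for every feasible direction w = z' - z (the other subgradients relative to
   Z differ from the gradient by normal vectors).  It is -oo when r has no
   subgradient at z, as for the negative entropy on the boundary of a
   simplex. *)
Definition grad_pairing (z w : E) : \bar R :=
  ereal_sup [set (dot gamma w)%:E | gamma in subdifferential z].

(* Convexity is not redundant: the inequality alone says nothing at points
   without subgradients. *)
Definition strongly_convex1 (nrm : E -> R) : Prop :=
  convex_function Z r /\
  forall z z', Z z -> Z z' ->
    ((r z)%:E + grad_pairing z (z' - z) + (2^-1 * nrm (z' - z) ^+ 2)%:E
       <= (r z')%:E)%E.

(* [bregman z z'] is V_z(z'); for z' in Z it is finite if and only if r has a
   subgradient at z, and +oo otherwise. *)
Definition bregman (z z' : E) : \bar R :=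
  ((r z')%:E - (r z)%:E - grad_pairing z (z' - z))%E.

(* [l] is the one-sided derivative of [f] at [z] in the direction [d], that is
   <nabla f(z), d> *)
Definition is_dir_derive (f : E -> \bar R) (z d : E) (l : \bar R) : Prop :=
  ((s^-1)%:E * (f (z + s *: d)%R - f z))%E @[s --> (0 : R)^'+] --> l.

(* - <nabla V_z(z'), z' - u> = V_z(u) - V_z'(u) - V_z(z'), whenever the three
   terms of the right-hand side are finite; the left-hand side is the
   derivative of V_z at z' towards u.  For a differentiable r, and for the
   entropy, this holds automatically.  It is not automatic for a general
   non-differentiable convex r, for which w |-> <nabla r(z), w> need not be
   linear. *)
Definition bregman_three_point : Prop :=
  forall z z' u, Z z -> Z z' -> Z u ->
    bregman z u \is a fin_num -> bregman z' u \is a fin_num ->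
    bregman z z' \is a fin_num ->
    is_dir_derive (bregman z) z' (u - z')
      (bregman z u - bregman z' u - bregman z z')%E.

Definition monotone_operator (g : E -> E) : Prop :=
  forall z z', Z z -> Z z' -> 0 <= dot (g z' - g z) (z' - z).

(* <g(za) + alpha nabla V_z(za), za - u> <= 0 for all u in Z, where
   <nabla V_z(za), za - u> is minus the derivative of V_z at za towards u. *)
Definition is_prox (alpha : R) (g : E -> E) (z za : E) : Prop :=
  Z za /\
  forall u, Z u ->
    exists2 l, is_dir_derive (bregman z) za (u - za) l &
      ((dot (g za) (za - u))%:E - alpha%:E * l <= 0)%E.

Definition is_argmin (F : E -> \bar R) (w : E) : Prop :=
  Z w /\ forall w', Z w' -> (F w <= F w')%E.

Definition step_objective (alpha eta : R) (w0 wprev zeta w : E) : \bar R :=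
  ((dot zeta w)%:E + alpha%:E * bregman w0 w
     + (eta^-1)%:E * bregman wprev w)%E.

End distance_generating_function.

Section stochastic_estimators.
Context (R : realType) (k : nat) (d : measure_display)
  (Xi : measurableType d) (Q : probability Xi R).
Notation E := 'rV[R]_k.

Definition has_mean (U : Xi -> E) (m : E) : Prop :=
  forall i, Q.-integrable setT (fun x => (U x ord0 i)%:E) /\
    ('E_Q[fun x => U x ord0 i] = (m ord0 i)%:E)%E.

(* One evaluation of the estimator at z is [gt z x] with x of law Q. *)
Definition centered_estimator (Z : set E) (nrm : E -> R) (g : E -> E)
    (z0 : E) (L : R) (gt : E -> Xi -> E) : Prop :=
  forall z, Z z ->
    has_mean (gt z) (g z) /\
    ('E_Q[fun x => (dual_norm nrm (gt z x - g z0) ^+ 2)%R]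
       <= (L ^+ 2 * nrm (z - z0) ^+ 2)%:E)%E.

End stochastic_estimators.

Section restarted_mirror_descent.
Context (R : realType) (k : nat) (Xi : Type).
Notation E := 'rV[R]_k.

(* [upd zc w x] is the mirror descent step from w, in a phase started at zc,
   when the estimator gt zc is evaluated at w with the random seed x. *)
Definition is_step_map (Z : set E) (r : E -> R) (alpha eta : R) (w0 : E)
    (gt : E -> E -> Xi -> E) (upd : E -> E -> Xi -> E) : Prop :=
  forall zc w x, Z zc -> Z w ->
    is_argmin Z (step_objective Z r alpha eta w0 w (gt zc w x)) (upd zc w x).

Variable upd : E -> E -> Xi -> E.

(* w_t of a phase started at zc, where x t is the seed used by step t *)
Fixpoint phase_iterate (zc : E) (x : nat -> Xi) (t : nat) : E :=
  if t is t'.+1 then upd zc (phase_iterate zc x t') (x t) else zc.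

(* The output of nu phases, where phase p has length [tau p] and its step t
   uses the seed [x p t]; phases and steps are numbered from 1. *)
Fixpoint smd_output (w0 : E) (tau : nat -> nat) (x : nat -> nat -> Xi)
    (nu : nat) : E :=
  if nu is nu'.+1 then
    phase_iterate (smd_output w0 tau x nu') (x nu) (tau nu)
  else w0.

End restarted_mirror_descent.

Section randomness.
Context (R : realType) (d : measure_display) (Omega : measurableType d)
  (P : probability Omega R).

Definition mutually_independent (I : eqType) (D : set I)
    (sigma : I -> set_system Omega) : Prop :=
  forall (J : seq I) (A : I -> set Omega), uniq J ->
    (forall i, i \in J -> D i /\ sigma i (A i)) ->
    P (\bigcap_(i in [set` J]) A i) = (\prod_(i <- J) fine (P (A i)))%:E.

(* Draws are indexed by [inl nu], the length of phase nu, and [inr (nu, t)],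
   the seed of step t of phase nu. *)
Definition draw_domain (N T : nat) : set (nat + nat * nat) :=
  [set i | match i with
           | inl nu => (1 <= nu <= N)%N
           | inr (nu, t) => (1 <= nu <= N)%N && (1 <= t <= T)%N
           end].

Definition draw_events (d' : measure_display) (Xi : measurableType d')
    (tau : nat -> Omega -> nat) (xi : nat -> nat -> Omega -> Xi)
    (i : nat + nat * nat) : set_system Omega :=
  match i with
  | inl nu => preimage_set_system setT (tau nu) measurable
  | inr (nu, t) => preimage_set_system setT (xi nu t) measurable
  end.

Definition fresh_draws (d' : measure_display) (Xi : measurableType d')
    (Q : probability Xi R) (N T : nat)
    (tau : nat -> Omega -> nat) (xi : nat -> nat -> Omega -> Xi) : Prop :=
  [/\ forall nu, (1 <= nu <= N)%N ->
        [/\ measurable_fun setT (tau nu),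
            forall omega, (1 <= tau nu omega <= T)%N &
            forall t, (1 <= t <= T)%N ->
              P (tau nu @^-1` [set t]) = (T%:R^-1)%:E],
      forall nu t, (1 <= nu <= N)%N -> (1 <= t <= T)%N ->
        measurable_fun setT (xi nu t) /\
        forall A, measurable A -> P (xi nu t @^-1` A) = Q A &
      mutually_independent (draw_domain N T) (draw_events tau xi)].

End randomness.

(* Main.v *)
Require Import Defs.
From HB Require Import structures.
From mathcomp Require Import all_boot all_order all_algebra.
From mathcomp Require Import all_classical all_reals all_analysis.
From mathcomp Require Import ring lra measurable_realfun.

Set Implicit Arguments.
Unset Strict Implicit.
Unset Printing Implicit Defensive.

Import Order.TTheory GRing.Theory Num.Theory.
Import numFieldNormedType.Exports.

Local Open Scope classical_set_scope.
Local Open Scope ring_scope.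

(* If r has no subgradient at w0, the right-hand side is +oo.  Otherwise the
   three-point identity forces u |-> <nabla r(z), u - z> to be affine on Z at
   every z with a subgradient; hence all iterates and zalpha have subgradients
   too, and satisfy the usual variational inequalities.

   In a phase started at zc, add the inequalities of the step w -> w' (towards
   zalpha) and of the proximal point (towards w'), and split
     <g~(w) - g(zalpha), w' - zalpha> = <g~(w) - g(zalpha), w - zalpha>
       + <g~(w) - g(zc), w' - w> + <g(zc) - g(zalpha), w' - w>.
   In expectation the first term is nonnegative by monotonicity; the second one
   is bounded by Young's inequality and the variance of the centered estimator;
   the third one telescopes.  So the expectation of the potential
     V_w(zalpha) / eta + <g(zc) - g(zalpha), w - zalpha>
       + alpha / 8 * (|w - zalpha|^2 + |zc - zalpha|^2) >= 0
   plus alpha * V_w(zalpha) grows by at most alpha / 4 * V_zc(zalpha) in a step.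
   Averaging over the uniform length of the phase contracts the divergence by
   1 / (eta * alpha * T) + 1 / 4 <= 1 / 2. *)

(** * Bilinearity of the pairing, and coordinates bounded by the sup norm *)

Section dot_product.
Context (R : realType) (k : nat).
Implicit Types (u v w : 'rV[R]_k) (a : R).

Lemma dotDl u v w : dot (u + v) w = dot u w + dot v w.
Proof.
by rewrite /dot -big_split/=; apply: eq_bigr => i _; rewrite mxE mulrDl.
Qed.

Lemma dotDr u v w : dot u (v + w) = dot u v + dot u w.
Proof.
by rewrite /dot -big_split/=; apply: eq_bigr => i _; rewrite mxE mulrDr.
Qed.

Lemma dotZl a u v : dot (a *: u) v = a * dot u v.
Proof. by rewrite /dot mulr_sumr; apply: eq_bigr => i _; rewrite mxE mulrA. Qed.

Lemma dotZr a u v : dot u (a *: v) = a * dot u v.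
Proof. by rewrite /dot mulr_sumr; apply: eq_bigr => i _;
  rewrite mxE mulrCA. Qed.

Lemma dotNl u v : dot (- u) v = - dot u v.
Proof. by rewrite -scaleN1r dotZl mulN1r. Qed.

Lemma dotNr u v : dot u (- v) = - dot u v.
Proof. by rewrite -scaleN1r dotZr mulN1r. Qed.

Lemma dotBl u v w : dot (u - v) w = dot u w - dot v w.
Proof. by rewrite dotDl dotNl. Qed.

Lemma dotBr u v w : dot u (v - w) = dot u v - dot u w.
Proof. by rewrite dotDr dotNr. Qed.

Lemma dot0l u : dot 0 u = 0.
Proof. by rewrite -(scale0r 0) dotZl mul0r. Qed.

Lemma dot0r u : dot u 0 = 0.
Proof. by rewrite -(scale0r 0) dotZr mul0r. Qed.

Lemma dot_delta u i : dot (delta_mx 0 i) u = u 0 i.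
Proof.
rewrite /dot (bigD1 i)//= big1 ?addr0 => [|j ji].
  by rewrite mxE !eqxx mul1r.
by rewrite mxE (negbTE ji) andbF mul0r.
Qed.

Lemma coord_le_norm u i : `|u 0 i| <= `|u|.
Proof.
rewrite [leRHS]/Num.norm/= mx_normrE; apply/bigmax_geP; right => /=.
by exists (ord0, i).
Qed.

End dot_product.

(** * Hahn-Banach in finite dimension: a linear minorant of a convex function *)

Section finite_dimensional_hahn_banach.
Context (R : realType) (k : nat).
Notation E := 'rV[R]_k.
(** [K v y] reads as f(v) <= y for a convex function f. Working with this relation allows f to be an
    infimal convolution without forming the infimum. *)
Variable K : E -> R -> Prop.
Hypothesis K_convex : forall (t : R) v y v' y', 0 < t < 1 -> K v y -> K v' y' ->
  K (t *: v + (1 - t) *: v') (t * y + (1 - t) * y').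
Hypothesis K_total : forall v, exists y, K v y.
Hypothesis K_ge0 : forall y, K 0 y -> 0 <= y.

(* The coordinates of gamma are chosen one at a time. *)
Let below j (gamma : E) := forall (v : E) y,
  (forall i : 'I_k, (j <= i)%N -> v 0 i = 0) -> K v y -> dot gamma v <= y.

Let below_step j (jk : (j < k)%N) gamma : below j gamma ->
  exists gamma', below j.+1 gamma'.
Proof.
move=> bg; pose e : E := delta_mx 0 (Ordinal jk).
pose supp (v : E) := forall i : 'I_k, (j <= i)%N -> v 0 i = 0.
(* Vectors [v - s *: e] bound the new coordinate from below, vectors [v' + t *: e] from above. The
   weights t/(s+t) and s/(s+t) cancel [e], so the convex combination is supported on the earlier
   coordinates, where [bg] applies; hence each lower bound is below each upper bound. *)
have cross v y s v' y' t : supp v -> supp v' -> 0 < s -> 0 < t ->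
    K (v - s *: e) y -> K (v' + t *: e) y' ->
    (dot gamma v - y) / s <= (y' - dot gamma v') / t.
  move=> sv sv' s0 t0 Kv Kv'.
  have st : 0 < s + t by exact: addr_gt0.
  have t01 : 0 < t / (s + t) < 1.
    by rewrite divr_gt0//= ltr_pdivrMr// mul1r ltrDr.
  have := K_convex t01 Kv Kv'.
  have -> : 1 - t / (s + t) = s / (s + t) by field; rewrite gt_eqF.
  have -> : (t / (s + t)) *: (v - s *: e) + (s / (s + t)) *: (v' + t *: e) =
      (t / (s + t)) *: v + (s / (s + t)) *: v'.
    by apply/rowP => i; rewrite !mxE; field; rewrite gt_eqF.
  move=> /bg; rewrite dotDr !dotZr => h.
  have {}h : t / (s + t) * dot gamma v + s / (s + t) * dot gamma v' <=
      t / (s + t) * y + s / (s + t) * y'.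
    by apply: h => i ji; rewrite !mxE sv// sv'// !mulr0 addr0.
  rewrite ler_pdivrMr// mulrAC ler_pdivlMr// -subr_ge0.
  have -> : (y' - dot gamma v') * s - (dot gamma v - y) * t =
    (t / (s + t) * y + s / (s + t) * y' -
     (t / (s + t) * dot gamma v + s / (s + t) * dot gamma v')) * (s + t).
    by field; rewrite gt_eqF.
  by rewrite mulr_ge0 ?subr_ge0// ltW.
pose C := [set c | exists v y s,
  [/\ supp v, 0 < s, K (v - s *: e) y & c = (dot gamma v - y) / s]].
have ubC v' y' t : supp v' -> 0 < t -> K (v' + t *: e) y' ->
    ubound C ((y' - dot gamma v') / t).
  move=> sv' t0 Kv' _ [v [y [s [sv s0 Kv ->]]]].
  exact: (cross v y s v' y' t).
have supp0 : supp 0 by move=> i _; rewrite mxE.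
have C0 : C !=set0.
  have [y Ky] := K_total (0 - 1 *: e).
  by exists ((dot gamma 0 - y) / 1), 0, y, 1.
have hubC : has_ubound C.
  have [y Ky] := K_total (0 + 1 *: e).
  by exists ((y - dot gamma 0) / 1); exact: ubC.
(* The coordinate [gj] of [gamma] is arbitrary so far, as [below j] does not see it; adding
   [(c - gj) *: e] overwrites it with [c]. *)
pose c := sup C; pose gj := gamma 0 (Ordinal jk).
exists (gamma + (c - gj) *: e) => v y vj Kv.
pose a := v 0 (Ordinal jk); pose v' := v - a *: e.
have sv' : supp v'.
  move=> i ji; rewrite !mxE; have [ij|ij] := eqVneq i (Ordinal jk).
    by rewrite ij !eqxx mulr1 subrr.
  rewrite eqxx/= mulr0 subr0 vj// ltn_neqAle ji andbT.
  by apply: contra ij => /eqP ij; apply/eqP/val_inj.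
have -> : dot (gamma + (c - gj) *: e) v = dot gamma v' + a * c.
  rewrite dotDl dotZl dot_delta -/a /v' dotBr dotZr.
  have -> : dot gamma e = gj by rewrite /gj -dot_delta /dot;
    apply: eq_bigr => i _; rewrite mulrC.
  by ring.
have [a0|a0|a0] := ltgtP 0 a.
- have : c <= (y - dot gamma v') / a.
    by apply: ge_sup => //; apply: ubC => //; rewrite /v' subrK.
  by rewrite ler_pdivlMr// mulrC lerBrDl.
- have : (dot gamma v' - y) / (- a) <= c.
    apply: ub_le_sup => //; exists v', y, (- a); split=> //.
    + by rewrite oppr_gt0.
    + by rewrite /v' scaleNr opprK subrK.
  by rewrite ler_pdivrMr ?oppr_gt0// mulrN -(mulrC a); lra.
- rewrite -a0 mul0r addr0; apply: bg => //.
  by rewrite /v' -a0 scale0r subr0.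
Qed.

Lemma hahn_banach_minorant : exists gamma, forall v y, K v y ->
  dot gamma v <= y.
Proof.
suff [gamma bg] : exists gamma, below k gamma.
  by exists gamma => v y; apply: bg => i; rewrite leqNgt ltn_ord.
suff : forall j, (j <= k)%N -> exists gamma, below j gamma by exact.
elim=> [_|j IH jk]; last by have [gamma] := IH (ltnW jk); exact: below_step.
exists 0 => v y v0 Kvy; rewrite dot0l; apply: K_ge0.
suff -> : 0 = v by [].
by apply/rowP => i; rewrite v0// mxE.
Qed.

End finite_dimensional_hahn_banach.

(** * Convexity of sets and functions with a real coefficient instead of one of interval type *)

Lemma convex_setP (R : realType) (k : nat) (Z : set 'rV[R]_k) :
  convex_set Z -> forall (t : R) x y, 0 <= t <= 1 -> Z x -> Z y ->
  Z (t *: x + (1 - t) *: y).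
Proof.
move=> cZ t x y /andP[t0 t1] Zx Zy.
have t01 : Itv.spec (@Itv.num_sem R) (Itv.Real `[0%Z, 1%Z]) t.
  by rewrite /Itv.num_sem/= num_real/= in_itv/= t0 t1.
by have := cZ x y (Itv.mk t01); rewrite !inE; apply.
Qed.

Lemma convex_functionP (R : realType) (k : nat) (Z : set 'rV[R]_k)
    (f : 'rV[R]_k -> R) :
  convex_function Z f -> forall (t : R) x y, 0 <= t <= 1 -> Z x -> Z y ->
  f (t *: x + (1 - t) *: y) <= t * f x + (1 - t) * f y.
Proof.
move=> cf t x y /andP[t0 t1] Zx Zy.
have t01 : Itv.spec (@Itv.num_sem R) (Itv.Real `[0%Z, 1%Z]) t.
  by rewrite /Itv.num_sem/= num_real/= in_itv/= t0 t1.
by have := cf (Itv.mk t01) x y; rewrite !inE; apply.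
Qed.

(** * Existence of subgradients in the relative interior of a convex set *)

Section subgradients_of_convex_functions.
Context (R : realType) (k : nat).
Notation E := 'rV[R]_k.
Variables (Z : set E) (f : E -> R).
Hypothesis Zconv : forall (t : R) x y, 0 <= t <= 1 -> Z x -> Z y ->
  Z (t *: x + (1 - t) *: y).
Hypothesis fconv : forall (t : R) x y, 0 <= t <= 1 -> Z x -> Z y ->
  f (t *: x + (1 - t) *: y) <= t * f x + (1 - t) * f y.

(* Hahn-Banach is applied to the infimal convolution of [f] and a multiple of
   the norm, which is finite everywhere. *)
Lemma calm_subdifferential b M : 0 <= M -> Z b ->
  (forall u, Z u -> f b - M * `|u - b| <= f u) ->
  subdifferential Z f b !=set0.
Proof.
move=> M0 Zb calm.
pose K v y := exists u w, [/\ Z u, v = u - b + w & f u - f b + M * `|w| <= y].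
have [gamma gammaK] : exists gamma, forall v y, K v y -> dot gamma v <= y.
  apply: hahn_banach_minorant.
  - move=> t v y v' y' /andP[t0 t1] [u [w [Zu -> uy]]] [u' [w' [Zu' -> uy']]].
    have t01 : 0 <= t <= 1 by rewrite !ltW.
    exists (t *: u + (1 - t) *: u'), (t *: w + (1 - t) *: w'); split.
    + exact: Zconv.
    + by apply/rowP => i; rewrite !mxE; ring.
    + have := fconv t01 Zu Zu'.
      have : `|t *: w + (1 - t) *: w'| <= t * `|w| + (1 - t) * `|w'|.
        rewrite (le_trans (ler_normD _ _))// !normrZ.
        by rewrite !ger0_norm ?subr_ge0// ltW.
      move=> /(ler_wpM2l M0) h1 h2.
      have := ler_wpM2l (ltW t0) uy.
      have := ler_wpM2l (_ : 0 <= 1 - t) uy'.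
      by rewrite subr_ge0 (ltW t1) => /(_ isT) h3 h4; lra.
  - by move=> v; exists (M * `|v|), b, v; rewrite !subrr !add0r.
  - move=> y [u [w [Zu /esym/eqP]]]; rewrite addrC addr_eq0 => /eqP ->.
    by rewrite normrN => uy; have := calm u Zu; lra.
exists gamma => u Zu; have : K (u - b) (f u - f b).
  by exists u, 0; rewrite addr0 normr0 mulr0 addr0.
by move=> /gammaK; lra.
Qed.

(** The weight missing from 1 is carried by [b]. The induction splits off the last vector, of weight
    a, and rescales the other weights by 1/(1 - a). *)
Lemma convex_combination b (n : nat) (v : 'I_n -> E) (l : 'I_n -> R) :
  Z b -> (forall i, Z (b + v i)) -> (forall i, 0 <= l i) ->
  \sum_i l i <= 1 -> Z (b + \sum_i l i *: v i).
Proof.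
move=> Zb; elim: n v l => [v l _ _ _|n IH v l Zv l0].
  by rewrite big_ord0 addr0.
rewrite !big_ord_recr/= => l1; set a := l ord_max in l1 *.
set S := \sum_(i < n) l _ in l1.
have a0 : 0 <= a by exact: l0.
have S0 : 0 <= S by apply: sumr_ge0.
(* Here the rescaling would divide by zero, but all other weights vanish. *)
have [a1|a1] := eqVneq a 1.
  rewrite big1 ?add0r ?a1 ?scale1r// => i _.
  have S00 : S = 0 by apply/eqP; rewrite eq_le S0 andbT; move: l1; rewrite a1;
    lra.
  suff -> : l (widen_ord (leqnSn n) i) = 0 by rewrite scale0r.
  move/eqP: S00; rewrite /S psumr_eq0// => /allP/(_ i).
  by rewrite mem_index_enum/= => /(_ isT)/eqP.
have {}a1 : a < 1 by rewrite lt_neqAle a1/=; lra.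
have -> : b + (\sum_(i < n) l (widen_ord (leqnSn n) i) *: v (widen_ord (leqnSn
  n) i)
    + a *: v ord_max) =
    a *: (b + v ord_max) + (1 - a) *: (b + \sum_(i < n)
    (l (widen_ord (leqnSn n) i) / (1 - a)) *: v (widen_ord (leqnSn n) i)).
  have -> : \sum_(i < n) (l (widen_ord (leqnSn n) i) / (1 - a)) *:
      v (widen_ord (leqnSn n) i) =
      (1 - a)^-1 *: \sum_(i < n) l (widen_ord (leqnSn n) i) *: v (widen_ord
        (leqnSn n) i).
    by rewrite scaler_sumr; apply: eq_bigr => i _; rewrite scalerA mulrC.
  rewrite !scalerDr scalerA divff ?scale1r ?gt_eqF ?subr_gt0//.
  by rewrite addrACA -scalerDl subrKC scale1r addrC addrA addrAC -addrA addrC.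
apply: Zconv => //; first by rewrite a0 ltW.
apply: IH => // [i|]; first by rewrite divr_ge0// subr_ge0 ltW.
by rewrite -mulr_suml ler_pdivrMr ?subr_gt0// mul1r lerBrDr.
Qed.

(** As long as some direction [u - b] lies outside the row space, adding it as a row raises the
    rank, which cannot exceed [k]. *)
Lemma spanning_rows b : Z b -> exists m (A : 'M[R]_(m, k)),
  (forall i, Z (b + row i A)) /\ forall u, Z u -> (u - b <= A)%MS.
Proof.
move=> Zb; apply: contrapT => no.
have : forall r, exists m (A : 'M[R]_(m, k)),
    (forall i, Z (b + row i A)) /\ (r <= \rank A)%N.
  elim=> [|r [m [A [ZA rA]]]]; first by exists 0, 0; split => // -[].
  have [u /not_implyP[Zu /negP uA]] : exists u, ~ (Z u -> (u - b <= A)%MS).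
    by apply/existsNP => h; apply: no; exists m, A.
  exists (m + 1)%N, (col_mx A (u - b)); split=> [i|].
    rewrite -(splitK i); case: (fintype.split i) => j /=.
    - by rewrite rowKu.
    - by rewrite rowKd row_id subrKC.
  apply: leq_ltn_trans rA _; apply: rank_ltmx.
  rewrite ltmxE -!addsmxE addsmxSl/=.
  by apply: contra uA => AA; exact: submx_trans (addsmxSr _ _) AA.
by move=> /(_ k.+1)[m [A [_]]]; rewrite ltnNge rank_leq_col.
Qed.


(* [b] and the points [b + s *: (u - b)] lie in the relative interior of [Z],
   which is described by coordinates on the rows of a matrix spanning the
   directions of [Z]. *)
Lemma core_points B : Z !=set0 -> (forall u, Z u -> f u <= B) ->
  exists b, [/\ Z b, subdifferential Z f b !=set0 & forall u, Z u ->
    exists s, [/\ 0 < s <= 1, Z (b - s *: (u - b)),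
      Z (b + s *: (u - b)) & subdifferential Z f (b + s *: (u - b)) !=set0]].
Proof.
move=> [b0 Zb0] fB; have [m [A [ZA spanA]]] := spanning_rows Zb0.
pose e (w : E) := w *m pinvmx A.
pose C := 1 + \sum_i \sum_j `|pinvmx A i j|.
have C0 : 0 < C by rewrite ltr_pwDl// sumr_ge0// => i _; rewrite sumr_ge0.
have eC w i : `|e w 0 i| <= C * `|w|.
  rewrite mxE (le_trans (ler_norm_sum _ _ _))// mulrC.
  apply: (@le_trans _ _ (\sum_j `|w| * `|pinvmx A j i|)).
    by apply: ler_sum => j _; rewrite normrM ler_wpM2r// coord_le_norm.
  rewrite -mulr_sumr ler_wpM2l// (@le_trans _ _ (\sum_j \sum_i `|pinvmx A j
    i|))//.
    by apply: ler_sum => j _; rewrite (bigD1 i)//= lerDl sumr_ge0.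
  by rewrite lerDr.
pose p (l : 'rV[R]_m) : E := b0 + l *m A.
(* The coordinates of a simplex with vertices in [Z], shrunk by a margin [d]: [core 0] is the whole
   simplex. *)
pose core d (l : 'rV[R]_m) := (forall i, d <= l 0 i) /\ \sum_i l 0 i <= 1 - d.
have Zp l : core 0 l -> Z (p l).
  rewrite /core subr0 /p mulmx_sum_row => -[l0 l1].
  exact: convex_combination.
(* Moving each coordinate by at most d'/(m+1) changes it, and also the sum of the [m] coordinates,
   by at most d'. *)
have core_sub (d d' : R) (l e' : 'rV[R]_m) : 0 <= d' -> core d l ->
    (forall i, `|e' 0 i| <= d' / m.+1%:R) -> core (d - d') (l - e').
  move=> d'0 [dl ld] ed; have ed' i : `|e' 0 i| <= d'.
    by rewrite (le_trans (ed i))// ler_pdivrMr// ler_peMr// ler1n.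
  split=> [i|].
    by rewrite !mxE lerB// (le_trans (ler_norm _)).
  under eq_bigr do rewrite !mxE.
  rewrite big_split/= sumrN.
  have : - (\sum_i e' 0 i) <= d'.
    rewrite (le_trans (ler_norm _))// normrN (le_trans (ler_norm_sum _ _ _))//.
    rewrite (le_trans (ler_sum _ (fun i _ => ed i)))//.
    rewrite sumr_const card_ord -[leLHS]mulr_natr -mulrA ler_piMr// mulrC.
    by rewrite ler_pdivrMr// mul1r ler_nat.
  by move: ld; lra.
have eK l u : Z u -> e (u - p l) *m A = u - p l.
  move=> Zu; rewrite /e mulmxKpV// /p opprD addrA addmx_sub ?spanA//.
  by rewrite eqmx_opp submxMl.
have p_sub l u t : Z u -> p l - t *: (u - p l) = p (l - t *: e (u - p l)).
  by move=> Zu; rewrite [in RHS]/p mulmxBl -scalemxAl eK// addrA.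
(* The margin lets the segment from [u] to [p l] be prolonged beyond [p l] by a length [rho] that
   does not depend on [u]. Convexity along it and the bound [B] at the far end give calmness at
   [p l] with constant (B - f(p l))/rho. *)
have sub_core d l : 0 < d -> core d l -> subdifferential Z f (p l) !=set0.
  move=> d0 ld.
  have Zpl : Z (p l).
    by apply: Zp; case: ld => l1 l2; split=> [i|];
      [rewrite (le_trans _ (l1 i))// ltW|lra].
  pose rho := d / m.+1%:R / C.
  have rho0 : 0 < rho by rewrite !divr_gt0.
  apply: (@calm_subdifferential _ ((B - f (p l)) / rho)) => //.
    by rewrite divr_ge0 ?subr_ge0 ?fB// ltW.
  move=> u Zu; have [->|up] := eqVneq u (p l).
    by rewrite subrr normr0 mulr0 subr0.
  have n0 : 0 < `|u - p l| by rewrite normr_gt0 subr_eq0.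
  pose t := rho / `|u - p l|; have t0 : 0 < t by rewrite divr_gt0.
  have Zv : Z (p l - t *: (u - p l)).
    rewrite p_sub//; apply: Zp; rewrite -(subrr d);
      apply: core_sub (ltW d0) ld _.
    move=> i; rewrite mxE normrM (gtr0_norm t0).
    rewrite (le_trans (ler_wpM2l (ltW t0) (eC _ _)))//.
    rewrite /t /rho le_eqVlt; apply/orP; left; apply/eqP.
    by field; rewrite !gt_eqF//= nat1r addrC pnatr_eq0.
  have t01 : 0 <= (1 + t)^-1 <= 1.
    by rewrite invr_ge0 invf_le1 ?lerDl ?addr_ge0// ?addr_gt0// ltW.
  have := fconv t01 Zv Zu.
  have -> : (1 + t)^-1 *: (p l - t *: (u - p l)) + (1 - (1 + t)^-1) *: u = p l.
    by apply/rowP => i; rewrite !mxE; field; rewrite gt_eqF ?addr_gt0.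
  set fv := f (p l - _) => h.
  have {}h : (1 + t) * f (p l) <= fv + t * f u.
    rewrite -ler_pdivlMl ?addr_gt0// (le_trans h)// le_eqVlt; apply/orP; left.
    by apply/eqP; field; rewrite gt_eqF ?addr_gt0.
  have fvB : fv <= B by exact: fB.
  have -> : (B - f (p l)) / rho * `|u - p l| = (B - f (p l)) / t.
    by rewrite /t; field; rewrite !gt_eqF.
  rewrite lerBlDr -lerBlDl ler_pdivlMr//; lra.
(* The barycenter: [m] coordinates equal to 1/(m+1) sum up to 1 - d. *)
pose d : R := m.+1%:R^-1; have d0 : 0 < d by rewrite invr_gt0.
pose l0 : 'rV[R]_m := const_mx d.
have core0 : core d l0.
  split=> [i|]; first by rewrite mxE.
  under eq_bigr do rewrite mxE.
  rewrite sumr_const card_ord -[leLHS]mulr_natr.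
  have : d * m.+1%:R = 1 by rewrite mulVf.
  by rewrite -natr1 mulrDr mulr1; lra.
have Zpd d' l : 0 <= d' -> core d' l -> Z (p l).
  move=> d'0 [l1 l2]; apply: Zp.
  by split=> [i|]; [exact: (le_trans d'0 (l1 i))|lra].
exists (p l0); split; [exact: Zpd (ltW d0) core0|exact: sub_core core0|].
move=> u Zu.
(* A move by [s] in either direction uses half of the margin, so [core (d / 2)] still holds at both
   ends. The summand 1 in the denominator keeps [s] well defined and at most 1 when [u] is
   [p l0]. *)
pose s := d / 2 / m.+1%:R / (1 + C * `|u - p l0|).
have C1 : 0 < 1 + C * `|u - p l0| by rewrite ltr_pwDl// mulr_ge0// ltW.
have s0 : 0 < s by rewrite !divr_gt0.
have ls t i : `|t| = s -> `|(t *: e (u - p l0)) 0 i| <= d / 2 / m.+1%:R.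
  move=> ts; rewrite mxE normrM ts.
  rewrite (le_trans (ler_wpM2l (ltW s0) (eC _ _)))// /s mulrAC ler_pdivrMr//.
  by rewrite ler_wpM2l ?divr_ge0//; lra.
have cs t : `|t| = s -> core (d / 2) (l0 - t *: e (u - p l0)).
  move=> ts; have -> : d / 2 = d - d / 2 by field.
  by apply: core_sub => [||i]; [lra|exact: core0|exact: ls].
have ns : `|- s| = s by rewrite normrN gtr0_norm.
have d2 : 0 < d / 2 by lra.
exists s; have -> : p l0 + s *: (u - p l0) = p l0 - (- s) *: (u - p l0).
  by rewrite scaleNr opprK.
rewrite !p_sub//; split.
- rewrite s0/= /s ler_pdivrMr// mul1r.
  apply: (@le_trans _ _ 1); last by rewrite lerDl mulr_ge0// ltW.
  have d1 : d <= 1 by rewrite invf_le1// ler1n.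
  by rewrite ler_pdivrMr// mul1r (@le_trans _ _ 1)// ?ler1n//; lra.
- by apply: (@Zpd (d / 2)); [exact: ltW|apply: cs; exact: gtr0_norm].
- by apply: (@Zpd (d / 2)); [exact: ltW|exact: cs].
- by apply: (@sub_core (d / 2)) => //; exact: cs.
Qed.

End subgradients_of_convex_functions.

(** * Consequences of the three-point identity: slopes of r are affine *)

Section bregman_divergence.
Context (R : realType) (k : nat).
Notation E := 'rV[R]_k.
Variables (Z : set E) (r : E -> R).
Hypothesis Zconv : forall (t : R) x y, 0 <= t <= 1 -> Z x -> Z y ->
  Z (t *: x + (1 - t) *: y).
Hypothesis rconv : forall (t : R) x y, 0 <= t <= 1 -> Z x -> Z y ->
  r (t *: x + (1 - t) *: y) <= t * r x + (1 - t) * r y.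
Hypothesis r_ub : has_ubound (r @` Z).
Hypothesis three_point : bregman_three_point Z r.

Definition subdiff_dom : set E := [set z | Z z /\ subdifferential Z r z !=set0].
Notation D := subdiff_dom.

(** The pairing of nabla r(z) with u - z as a real number. The value of [fine] is meaningful for [z]
    in [D] and [u] in [Z]: the pairing is then bounded below by any subgradient and above by r(u) -
    r(z). *)
Definition dir_slope (z u : E) : R := fine (grad_pairing Z r z (u - z)).
Notation q := dir_slope.

Definition breg (z u : E) : R := r u - r z - q z u.

Lemma subdiff_domW z : D z -> Z z. Proof. by case. Qed.

Let subgrad_le z u c : Z u -> subdifferential Z r z c ->
  dot c (u - z) <= r u - r z.
Proof. by move=> Zu /(_ u Zu); rewrite lerBrDl. Qed.

Lemma grad_pairingE z u : D z -> Z u ->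
  grad_pairing Z r z (u - z) = (q z u)%:E.
Proof.
move=> [Zz [c cz]] Zu; rewrite /q fineK// fin_numE; apply/andP; split.
  apply/eqP => Noo; have : ((dot c (u - z))%:E <= grad_pairing Z r z (u - z))%E.
    by apply: ereal_sup_ubound; exists c.
  by rewrite Noo leeNy_eq.
rewrite -ltey (@le_lt_trans _ _ (r u - r z)%:E) ?ltry//.
by apply: ge_ereal_sup => _ [c' c'z <-]; rewrite lee_fin subgrad_le.
Qed.

Lemma bregmanE z u : D z -> Z u -> bregman Z r z u = (breg z u)%:E.
Proof. by move=> Dz Zu; rewrite /bregman grad_pairingE// -!EFinB. Qed.

Lemma bregman_notin z u : Z z -> ~ D z -> bregman Z r z u = +oo%E.
Proof.
move=> Zz nDz; rewrite /bregman /grad_pairing.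
have -> : subdifferential Z r z = set0.
  by rewrite -subset0 => c cz; apply: nDz; split=> //; exists c.
by rewrite image_set0 ereal_sup0 -EFinB.
Qed.

Lemma dir_slope_ge z u c : D z -> Z u -> subdifferential Z r z c ->
  dot c (u - z) <= q z u.
Proof.
move=> Dz Zu cz; rewrite -lee_fin -grad_pairingE//.
by apply: ereal_sup_ubound; exists c.
Qed.

Lemma dir_slope_le z u a : D z -> Z u ->
  (forall c, subdifferential Z r z c -> dot c (u - z) <= a) -> q z u <= a.
Proof.
move=> Dz Zu h; rewrite -lee_fin -grad_pairingE//.
by apply: ge_ereal_sup => _ [c cz <-]; rewrite lee_fin h.
Qed.

Lemma breg_ge0 z u : D z -> Z u -> 0 <= breg z u.
Proof.
by move=> Dz Zu; rewrite subr_ge0; apply: dir_slope_le => // c;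
  exact: subgrad_le.
Qed.

Lemma dir_slope_diag z : D z -> q z z = 0.
Proof.
move=> Dz; apply/eqP; rewrite eq_le dir_slope_le//=; last 2 first.
- exact: subdiff_domW.
- by move=> c _; rewrite subrr dot0r.
have [c cz] := Dz.2.
by have := dir_slope_ge Dz Dz.1 cz; rewrite subrr dot0r.
Qed.

Lemma breg_diag z : D z -> breg z z = 0.
Proof. by move=> Dz; rewrite /breg dir_slope_diag// subr0 subrr. Qed.

Let dir_slope_convex z (t : R) x y : D z -> 0 <= t <= 1 -> Z x -> Z y ->
  q z (t *: x + (1 - t) *: y) <= t * q z x + (1 - t) * q z y.
Proof.
move=> Dz t01 Zx Zy; apply: dir_slope_le => // [|c cz]; first exact: Zconv.
have -> : t *: x + (1 - t) *: y - z = t *: (x - z) + (1 - t) *: (y - z).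
  by apply/rowP => i; rewrite !mxE; ring.
move: t01 => /andP[t0 t1]; rewrite dotDr !dotZr.
by rewrite lerD// ler_wpM2l ?subr_ge0// dir_slope_ge.
Qed.

Let segment z u (s : R) : Z z -> Z u -> 0 <= s <= 1 -> Z (z + s *: (u - z)).
Proof.
move=> Zz Zu s01; have -> : z + s *: (u - z) = s *: u + (1 - s) *: z.
  by apply/rowP => i; rewrite !mxE; ring.
exact: Zconv.
Qed.

Let near_segment z u : Z z -> Z u ->
  \forall s \near (0 : R)^'+, 0 < s <= 1 /\ Z (z + s *: (u - z)).
Proof.
move=> Zz Zu; near=> s.
have s0 : 0 < s by near: s; exact: nbhs_right_gt.
have s1 : s <= 1 by near: s; exact: nbhs_right_le.
by split; [rewrite s0|apply: segment => //; rewrite ltW].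
Unshelve. all: by end_near. Qed.

Let breg_dir_derive z z' u : D z -> D z' -> Z u ->
  (breg z (z' + s *: (u - z')) - breg z z') / s @[s --> (0 : R)^'+] -->
  breg z u - breg z' u - breg z z'.
Proof.
move=> Dz Dz' Zu; have [Zz Zz'] := (subdiff_domW Dz, subdiff_domW Dz').
have := three_point Zz Zz' Zu; rewrite !bregmanE// => /(_ isT isT isT).
rewrite /is_dir_derive -!EFinB => /fine_cvgP[_]; apply: cvg_trans.
apply: near_eq_cvg; near=> s.
have [_ Zs] : 0 < s <= 1 /\ Z (z' + s *: (u - z')).
  by near: s; exact: near_segment.
by rewrite /= !bregmanE//= mulrC.
Unshelve. all: by end_near. Qed.

(** The three-point identity at z' = z says that V_z has zero one-sided derivative at z; adding the
    slope back gives the derivative of r. *)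
Lemma is_derive_dir_slope z u : D z -> Z u ->
  (r (z + s *: (u - z)) - r z) / s @[s --> (0 : R)^'+] --> q z u.
Proof.
move=> Dz Zu; have Zz := subdiff_domW Dz.
have := breg_dir_derive Dz Dz Zu.
rewrite breg_diag// subr0 subrr => h0.
rewrite -[q z u]add0r; apply: cvg_trans (cvgD h0 (cvg_cst _)).
apply: near_eq_cvg; near=> s.
have [/andP[s0 s1] Zs] : 0 < s <= 1 /\ Z (z + s *: (u - z)).
  by near: s; exact: near_segment.
(* Positive homogeneity of a supremum of linear forms. *)
have -> : q z u = q z (z + s *: (u - z)) / s.
  apply/eqP; rewrite eq_le; apply/andP; split.
    apply: dir_slope_le => // c cz; rewrite ler_pdivlMr// mulrC -dotZr.
    by have := dir_slope_ge Dz Zs cz; rewrite addrC addKr.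
  rewrite ler_pdivrMr//; apply: dir_slope_le => // c cz.
  by rewrite addrC addKr dotZr mulrC ler_pM2r// dir_slope_ge.
by rewrite fctE /breg /=; field; rewrite gt_eqF.
Unshelve. all: by end_near. Qed.

(** By convexity, the difference quotient of [q z] along the segment from z' to u is nondecreasing
    in the step. By the three-point identity its limit at step 0 equals its value at step 1, so it
    is constant. The limit needs a subgradient of r at z'. *)
Let dir_slope_ray z z' u (t : R) : D z -> D z' -> Z u -> 0 < t <= 1 ->
  q z (z' + t *: (u - z')) = (1 - t) * q z z' + t * q z u.
Proof.
move=> Dz Dz' Zu /andP[t0 t1]; have Zz' := subdiff_domW Dz'.
have conv s w : Z w -> 0 < s <= 1 ->
    (q z (z' + s *: (w - z')) - q z z') / s <= q z w - q z z'.
  move=> Zw /andP[s0 s1]; have -> : z' + s *: (w - z') = s *: w + (1 - s) *: z'.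
    by apply/rowP => i; rewrite !mxE; ring.
  rewrite ler_pdivrMr//.
  have := @dir_slope_convex z s w z' Dz; rewrite (ltW s0) s1 => /(_ isT Zw Zz').
  lra.
have Zt : Z (z' + t *: (u - z')) by apply: segment; rewrite ?(ltW t0).
suff : q z u - q z z' <= (q z (z' + t *: (u - z')) - q z z') / t.
  have := conv t u Zu; rewrite t0 t1 => /(_ isT).
  by rewrite ler_pdivrMr// ler_pdivlMr// => h1 h2; apply/eqP; rewrite eq_le;
    lra.
have lim : (q z (z' + s *: (u - z')) - q z z') / s @[s --> (0 : R)^'+] -->
    q z u - q z z'.
  have -> : q z u - q z z' = q z' u - (breg z u - breg z' u - breg z z').
    by rewrite /breg; ring.
  apply: cvg_trans (cvgB (is_derive_dir_slope Dz' Zu) (breg_dir_derive Dz Dz'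
    Zu)).
  apply: near_eq_cvg; near=> s => /=.
  by rewrite fctE /breg -mulrBl; congr (_ / _); ring.
apply: cvgr_to_le lim _; near=> s.
have [/andP[s0 s1] Zs] : 0 < s <= 1 /\ Z (z' + s *: (u - z')).
  by near: s; exact: near_segment.
have st : s <= t by near: s; exact: nbhs_right_le.
have := conv (s / t) (z' + t *: (u - z')) Zt.
rewrite divr_gt0// ler_pdivrMr// mul1r st => /(_ isT).
have -> : z' + (s / t) *: (z' + t *: (u - z') - z') = z' + s *: (u - z').
  by rewrite [z' + t *: _]addrC addrK scalerA divfK// gt_eqF.
by rewrite invf_div mulrA ler_pdivlMr// => h; rewrite mulrAC.
Unshelve. all: by end_near. Qed.

(* The previous lemma needs a subgradient at one end of the segment: contract
   the segment towards a point [b] of the relative interior. *)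
Let dir_slope_affine z (t : R) x y : D z -> Z x -> Z y -> 0 <= t <= 1 ->
  q z (t *: x + (1 - t) *: y) = t * q z x + (1 - t) * q z y.
Proof.
move=> Dz Zx Zy t01.
have [B rB] := r_ub.
have [||b [Zb rb core]] := @core_points _ _ Z r Zconv rconv B.
- by exists x.
- by move=> u Zu; apply: rB; exists u.
have Db : D b by [].
have [s [/andP[s0 s1] _ Zs Ds]] := core x Zx.
have Dxs : D (b + s *: (x - b)) by [].
have Zc := Zconv t01 Zx Zy.
have [->|t1] := eqVneq t 1.
  by rewrite subrr scale0r scale1r mul0r mul1r !addr0.
have Zys : Z (b + s *: (y - b)) by apply: segment; rewrite // ltW.
have t1' : 0 < 1 - t <= 1.
  by move: t01 => /andP[t0 t1']; rewrite subr_gt0 lt_neqAle t1 t1'/=; lra.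
have := dir_slope_ray Dz Dxs Zys t1'.
have -> : b + s *: (x - b) + (1 - t) *: (b + s *: (y - b) - (b + s *: (x - b)))
  =
    b + s *: ((t *: x + (1 - t) *: y) - b).
  by apply/rowP => i; rewrite !mxE; ring.
rewrite !(dir_slope_ray Dz Db)// ?s0 ?s1// subKr => h.
apply: (@mulfI _ s); first by rewrite gt_eqF.
by move: h; lra.
Qed.

(** The function [q z] is convex and bounded above by r - r(z), so it has a subgradient [c] at some
    relatively interior [b]. For [u] in [Z], the subgradient inequality at [u] and at a point of [Z]
    on the other side of [b], together with affinity, forces equality. *)
Lemma dir_slope_linear z : D z -> exists c, forall w u, Z w -> Z u ->
  q z u - q z w = dot c (u - w).
Proof.
move=> Dz; have [B rB] := r_ub; have Zz := subdiff_domW Dz.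
have [|||b [Zb [c cb] core]] := @core_points _ _ Z (q z) Zconv _ (B - r z).
- by move=> t x y *; exact: dir_slope_convex.
- by exists z.
- move=> u Zu; have := breg_ge0 Dz Zu; rewrite /breg.
  have : r u <= B by apply: rB; exists u.
  by lra.
suff eqc u : Z u -> q z u - q z b = dot c (u - b).
  exists c => w u Zw Zu.
  by have := eqc w Zw; have := eqc u Zu; rewrite !dotBr; lra.
move=> Zu; have [s [/andP[s0 s1] Zs _ _]] := core u Zu.
have := cb u Zu; have := cb _ Zs.
rewrite [b - _ - b]addrC addKr dotNr dotZr => h1 h2.
have s01 : 0 <= (1 + s)^-1 <= 1.
  by rewrite invr_ge0 invf_le1 ?lerDl ?addr_ge0// ?addr_gt0// ltW.
have := dir_slope_affine Dz Zs Zu s01.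
have -> : (1 + s)^-1 *: (b - s *: (u - b)) + (1 - (1 + s)^-1) *: u = b.
  by apply/rowP => i; rewrite !mxE; field; rewrite gt_eqF ?addr_gt0.
have -> : 1 - (1 + s)^-1 = s / (1 + s) by field; rewrite gt_eqF ?addr_gt0.
move=> /(congr1 (fun x => (1 + s) * x)).
have -> : (1 + s) * ((1 + s)^-1 * q z (b - s *: (u - b)) + s / (1 + s) * q z u)
  =
    q z (b - s *: (u - b)) + s * q z u.
  by field; rewrite gt_eqF ?addr_gt0.
move=> h3; apply/eqP; rewrite eq_le; apply/andP; split; last lra.
by rewrite -(ler_pM2l s0); lra.
Qed.

End bregman_divergence.

(** * Variational inequalities of the mirror descent step and of the proximal point *)

Section proximal_points.
Context (R : realType) (k : nat).
Notation E := 'rV[R]_k.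
Variables (Z : set E) (r : E -> R).
Hypothesis Zconv : forall (t : R) x y, 0 <= t <= 1 -> Z x -> Z y ->
  Z (t *: x + (1 - t) *: y).
Hypothesis rconv : forall (t : R) x y, 0 <= t <= 1 -> Z x -> Z y ->
  r (t *: x + (1 - t) *: y) <= t * r x + (1 - t) * r y.
Hypothesis r_ub : has_ubound (r @` Z).
Hypothesis three_point : bregman_three_point Z r.
Notation D := (subdiff_dom Z r).
Notation V := (breg Z r).

(** Slopes at [w0] and [wp] being affine, the objective on [Z] is (alpha + 1/eta) r plus an affine
    function. Minimality therefore exhibits a subgradient [c] of r at [w], and the inequality
    follows from [dot c (u - w)] being at most the slope at [w]. *)
Lemma argmin_step (alpha eta : R) w0 wp zeta w : 0 < alpha -> 0 < eta ->
  D w0 -> D wp -> is_argmin Z (step_objective Z r alpha eta w0 wp zeta) w ->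
  D w /\ forall u, Z u -> dot zeta (w - u) <=
    alpha * (V w0 u - V w u - V w0 w) + eta^-1 * (V wp u - V w u - V wp w).
Proof.
move=> a0 eta0 Dw0 Dwp [Zw wmin].
have [c0 c0E] := dir_slope_linear Zconv rconv r_ub three_point Dw0.
have [c1 c1E] := dir_slope_linear Zconv rconv r_ub three_point Dwp.
set beta := eta^-1; have b0 : 0 < beta by rewrite invr_gt0.
have ab : 0 < alpha + beta by exact: addr_gt0.
pose c := (alpha + beta)^-1 *: (alpha *: c0 + beta *: c1 - zeta).
have abc u : (alpha + beta) * dot c (u - w) =
    alpha * dot c0 (u - w) + beta * dot c1 (u - w) - dot zeta (u - w).
  by rewrite /c dotZl dotBl dotDl !dotZl; field; rewrite gt_eqF.
have cw : subdifferential Z r w c.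
  move=> u Zu; have := wmin u Zu.
  rewrite /step_objective !bregmanE// -!EFinM -!EFinD lee_fin -/beta => h.
  rewrite -lerBrDl -(ler_pM2l ab) abc -(c0E _ _ Zw Zu) -(c1E _ _ Zw Zu).
  by move: h; rewrite dotBr /breg; lra.
have Dw : D w by split=> //; exists c.
split=> // u Zu; have := dir_slope_ge Dw Zu cw.
rewrite -(ler_pM2l ab) abc -(c0E _ _ Zw Zu) -(c1E _ _ Zw Zu).
by rewrite !dotBr /breg; lra.
Qed.

(** As for the minimizer, a subgradient of r at [za] is built explicitly: c0 - g(za)/alpha, where c0
    represents the slope at [w0]. *)
Lemma prox_step (alpha : R) g w0 za : 0 < alpha -> D w0 ->
  is_prox Z r alpha g w0 za ->
  D za /\ forall u, Z u -> dot (g za) (za - u) <=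
    alpha * (V w0 u - V za u - V w0 za).
Proof.
move=> a0 Dw0 [Zza prox].
have [c0 c0E] := dir_slope_linear Zconv rconv r_ub three_point Dw0.
pose c := c0 - alpha^-1 *: g za.
have ac u : alpha * dot c (u - za) =
    alpha * dot c0 (u - za) + dot (g za) (za - u).
  rewrite /c dotBl dotZl -[za - u]opprB dotNr; field.
  by rewrite gt_eqF.
have cza : subdifferential Z r za c.
  move=> u Zu; have [l lV lg] := prox u Zu.
  (* It is not yet known that [za] lies in [D], so the three-point identity cannot give this
     derivative; convexity of r bounds every difference quotient instead. *)
  have lub : (l <= (r u - r za - dot c0 (u - za))%:E)%E.
    apply: cvge_to_le lV _; near=> s.
    have s0 : 0 < s by near: s; exact: nbhs_right_gt.
    have s1 : s <= 1 by near: s; exact: nbhs_right_le.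
    have s01 : 0 <= s <= 1 by rewrite ltW.
    have zs : za + s *: (u - za) = s *: u + (1 - s) *: za.
      by apply/rowP => i; rewrite !mxE; ring.
    have Zs : Z (za + s *: (u - za)) by rewrite zs; exact: Zconv.
    rewrite !bregmanE// -EFinB -EFinM lee_fin mulrC ler_pdivrMr//.
    have := c0E _ _ Zza Zs; rewrite [za + _ - za]addrC addKr dotZr.
    by have := rconv s01 Zu Zza; rewrite -zs /breg; lra.
  (* The value +oo contradicts [lub], and -oo contradicts [lg]. *)
  case: l lub lg {lV} => [l| |] //; last by rewrite gt0_muleNy ?lte_fin.
  rewrite -EFinM -EFinB !lee_fin => lub lg.
  rewrite -lerBrDl -(ler_pM2l a0) ac.
  by have := ler_wpM2l (ltW a0) lub; lra.
have Dza : D za by split=> //; exists c.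
split=> // u Zu; have := dir_slope_ge Dza Zu cza.
rewrite -(ler_pM2l a0) ac -(c0E _ _ Zza Zu) /breg; lra.
Unshelve. all: by end_near. Qed.

End proximal_points.

(** * Equivalence of norms, the dual norm and Young's inequality *)

Section norms.
Context (R : realType) (k : nat).
Notation E := 'rV[R]_k.
Variable nrm : E -> R.
Hypothesis hnrm : is_norm nrm.

Lemma is_normN u : nrm (- u) = nrm u.
Proof. by have [_ nZ _] := hnrm; rewrite -scaleN1r nZ normrN1 mul1r. Qed.

Lemma is_norm0 : nrm 0 = 0.
Proof. by have [_ nZ _] := hnrm; rewrite -(scale0r 0) nZ normr0 mul0r. Qed.

Lemma is_norm_ge0 u : 0 <= nrm u.
Proof.
have [nD _ _] := hnrm; have := nD u (- u).
by rewrite subrr is_norm0 is_normN; lra.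
Qed.

Lemma is_norm_gt0 u : u != 0 -> 0 < nrm u.
Proof.
have [_ _ n0] := hnrm; move=> u0; rewrite lt_neqAle is_norm_ge0 andbT.
by apply: contra u0 => /eqP/esym/n0 ->.
Qed.

Lemma is_norm_le : exists2 C : R, 0 < C & forall u, nrm u <= C * `|u|.
Proof.
have [nD nZ _] := hnrm.
(* The summand 1 makes the constant positive even in dimension 0. *)
exists (1 + \sum_i nrm (delta_mx 0 i)) => [|u].
  by rewrite ltr_pwDl// sumr_ge0// => i _; exact: is_norm_ge0.
have : nrm u <= \sum_i `|u 0 i| * nrm (delta_mx 0 i).
  rewrite {1}[u]row_sum_delta; elim/big_ind2 : _ => [|a x b y ax by_|i _].
  - by rewrite is_norm0.
  - by rewrite (le_trans (nD _ _))// lerD.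
  - by rewrite nZ.
move=> /le_trans; apply; rewrite mulrDl mul1r mulr_suml ler_wpDl//.
by apply: ler_sum => i _; rewrite mulrC ler_wpM2l ?is_norm_ge0// coord_le_norm.
Qed.

Lemma is_norm_dist u v : `|nrm u - nrm v| <= nrm (u - v).
Proof.
have [nD _ _] := hnrm; have := nD (u - v) v; have := nD (v - u) u.
by rewrite !subrK -opprB is_normN ler_norml => h1 h2; apply/andP; split; lra.
Qed.

Lemma lipschitz_continuous (f : E -> R) C :
  (forall u v, `|f u - f v| <= C * `|u - v|) -> continuous f.
Proof.
move=> fC u; apply/(@cvgrPdist_le _ _ _ (nbhs u) (nbhs_filter u)) => e e0.
have C0 : 0 < `|C| + 1 by rewrite ltr_wpDl.
near=> v; rewrite (le_trans (fC _ _))//.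
rewrite (@le_trans _ _ ((`|C| + 1) * `|u - v|))//.
  by rewrite ler_wpM2r// (le_trans (ler_norm _))// lerDl.
rewrite mulrC -ler_pdivlMr//; near: v.
apply/nbhs_ballP; exists (e / (`|C| + 1)) => /=; first exact: divr_gt0.
by move=> v; rewrite -ball_normE => /ltW.
Unshelve. all: by end_near. Qed.

Lemma is_norm_continuous : continuous nrm.
Proof.
have [C C0 nC] := is_norm_le; apply: (@lipschitz_continuous _ C) => u v.
exact: le_trans (is_norm_dist _ _) (nC _).
Qed.

(** The continuous function [nrm] has a positive minimum on the compact unit sphere of the sup norm.
    The trivial space is treated apart, its sphere being empty. *)
Lemma is_norm_ge : exists2 c : R, 0 < c & forall u, `|u| <= c * nrm u.
Proof.
have [nD nZ n0] := hnrm.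
have [k0|[v v0]] : (forall u : E, u = 0) \/ exists v : E, v != 0.
  by apply: contrapT => /not_orP[/existsNP[v /eqP v0]] /forallNP/(_ v).
  by exists 1 => // u; rewrite (k0 u) normr0 is_norm0 mulr0.
pose S := [set u : E | `|u| = 1].
have cS : compact S.
  apply: bounded_closed_compact.
    by exists 1; split=> // x x1 u /= ->; exact: ltW.
  by apply: (@preimage_closed _ _ (fun u : E => `|u|) [set 1]) => // x _;
    exact: norm_continuous.
have S0 : S !=set0.
  by exists (`|v|^-1 *: v); rewrite /S /= normrZ normfV normr_id mulVf//
    normr_eq0.
have [m] := compact_EVT_min S0 cS (continuous_subspaceT is_norm_continuous).
rewrite inE => mS mmin.
have m0 : 0 < nrm m.
  by apply: is_norm_gt0; rewrite -normr_gt0 mS.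
exists (nrm m)^-1 => [|u]; first by rewrite invr_gt0.
have [->|u0] := eqVneq u 0; first by rewrite normr0 is_norm0 mulr0.
have nu : 0 < `|u| by rewrite normr_gt0.
have := mmin (`|u|^-1 *: u).
rewrite inE /S /= normrZ normfV normr_id mulVf ?gt_eqF// => /(_ erefl).
by rewrite nZ normfV normr_id ler_pdivlMl// ler_pdivlMl// mulrC.
Qed.

(** [sup] takes a default value on unbounded sets; boundedness, from the comparison with the sup
    norm, makes [dual_norm] a true supremum. *)
Let dual_norm_has_sup zeta :
  has_sup [set dot zeta z | z in [set z | nrm z <= 1]].
Proof.
split; first by exists (dot zeta 0), 0 => //=; rewrite is_norm0.
have [c c0 nc] := is_norm_ge; exists (\sum_i `|zeta 0 i| * c) => _ [z /= z1 <-].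
rewrite (le_trans (ler_norm _))// (le_trans (ler_norm_sum _ _ _))//.
apply: ler_sum => i _; rewrite normrM ler_wpM2l//.
rewrite (le_trans (coord_le_norm _ _))// (le_trans (nc _))//.
by rewrite -[leRHS]mulr1 ler_wpM2l// ltW.
Qed.

Lemma dot_le_dual_norm zeta z : dot zeta z <= dual_norm nrm zeta * nrm z.
Proof.
have [_ nZ _] := hnrm.
have [->|z0] := eqVneq z 0; first by rewrite dot0r is_norm0 mulr0.
have nz := is_norm_gt0 z0; rewrite -ler_pdivrMr// mulrC -dotZr.
apply: sup_upper_bound => //; exists ((nrm z)^-1 *: z) => //=.
by rewrite nZ ger0_norm ?invr_ge0 ?is_norm_ge0// mulVf ?gt_eqF.
Qed.

Lemma dual_norm_ge0 zeta : 0 <= dual_norm nrm zeta.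
Proof.
rewrite -(dot0r zeta); apply: sup_upper_bound => //.
by exists 0 => //=; rewrite is_norm0.
Qed.

(** A Lipschitz bound with respect to the sup norm; it makes the squared deviation of the estimator
    measurable. *)
Lemma dual_norm_continuous : continuous (dual_norm nrm).
Proof.
have [c c0 nc] := is_norm_ge.
have le1 u v : dual_norm nrm u - dual_norm nrm v <= k%:R * c * `|u - v|.
  rewrite lerBlDr; apply: ge_sup; first exact: (dual_norm_has_sup u).1.
  move=> _ [z /= z1 <-]; rewrite -(subrK v u) dotDl addrK lerD//; last first.
    rewrite (le_trans (dot_le_dual_norm _ _))//.
    by rewrite -[leRHS]mulr1 ler_wpM2l ?dual_norm_ge0.
  rewrite (le_trans (ler_norm _))// (le_trans (ler_norm_sum _ _ _))//.
  rewrite (@le_trans _ _ (\sum_(i < k) `|u - v| * c))//.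
    apply: ler_sum => i _; rewrite normrM ler_pM// ?coord_le_norm//.
    rewrite (le_trans (coord_le_norm _ _))// (le_trans (nc _))//.
    by rewrite -[leRHS]mulr1 ler_wpM2l// ltW.
  by rewrite sumr_const card_ord -[leLHS]mulr_natl; lra.
apply: (@lipschitz_continuous _ (k%:R * c)) => u v.
have := le1 u v; have := le1 v u; rewrite [`|v - u|]distrC ler_norml.
by move=> h1 h2; apply/andP; split; lra.
Qed.

Lemma dot_young (eta : R) zeta z : 0 < eta ->
  dot zeta z <= eta / 2 * dual_norm nrm zeta ^+ 2 + (2 * eta)^-1 * nrm z ^+ 2.
Proof.
move=> e0; rewrite (le_trans (dot_le_dual_norm _ _))//.
set a := dual_norm nrm zeta; set b := nrm z.
rewrite -subr_ge0.
have -> : eta / 2 * a ^+ 2 + (2 * eta)^-1 * b ^+ 2 - a * b =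
    (2 * eta)^-1 * (eta * a - b) ^+ 2.
  by field; rewrite gt_eqF.
by rewrite mulr_ge0 ?sqr_ge0// invr_ge0 mulr_ge0// ltW.
Qed.

Lemma is_norm_sqrB u v w :
  nrm (u - v) ^+ 2 <= 2 * (nrm (u - w) ^+ 2 + nrm (v - w) ^+ 2).
Proof.
have [nD _ _] := hnrm; have := nD (u - w) (w - v).
rewrite addrA subrK -(opprB v w) is_normN.
have := is_norm_ge0 (u - v).
move: (nrm (u - v)) (nrm (u - w)) (nrm (v - w)) => a b c a0 abc.
have : a ^+ 2 <= (b + c) ^+ 2 by rewrite ler_pXn2r ?nnegrE//; lra.
by have := sqr_ge0 (b - c); lra.
Qed.

End norms.

(** * Measurability and expectations of random vectors *)

Section random_vectors.
Context (R : realType) (k : nat) (d : measure_display).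
Context (Xi : measurableType d) (Q : probability Xi R).
Notation E := 'rV[R]_k.

Lemma within_continuous_borel_measurable (Z : set E) (f : E -> R) :
  measurable (Z : set (borel R k)) -> {within Z, continuous f} ->
  measurable_fun (Z : set (borel R k)) (f : borel R k -> R).
Proof.
move=> mZ cf; apply: (measurability (@RGenOInfty.G R)) => //.
  exact: RGenOInfty.measurableE.
move=> _ [_ [x ->] <-].
have : open ((f : subspace Z -> R) @^-1` `]x, +oo[).
  by apply: open_comp => // z _; exact: cf.
move=> /open_subspaceP[V oV VZ]; rewrite setIC -VZ.
by apply: measurableI => //; exact: sub_sigma_algebra.
Qed.

Lemma continuous_borel_measurable (f : E -> R) :
  continuous f -> measurable_fun setT (f : borel R k -> R).
Proof.
by move=> cf; apply: within_continuous_borel_measurable => //;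
  exact: continuous_subspaceT.
Qed.

Lemma has_mean_dot (U : Xi -> E) m v : has_mean Q U m ->
  Q.-integrable setT (fun x => (dot (U x) v)%:E) /\
  (\int[Q]_x (dot (U x) v)%:E = (dot m v)%:E)%E.
Proof.
move=> Um.
have dotE x : (dot (U x) v)%:E = (\sum_i ((v 0 i)%:E * (U x 0 i)%:E))%E.
  by rewrite /dot -sumEFin; apply: eq_bigr => i _; rewrite -EFinM mulrC.
have intU i : Q.-integrable setT (fun x => ((v 0 i)%:E * (U x 0 i)%:E)%E).
  by apply: (integrableZl measurableT); have [] := Um i.
split.
  under eq_fun do rewrite dotE.
  by apply: (integrable_sum measurableT) => i _; exact: intU.
under eq_integral do rewrite dotE.
rewrite integral_sum// /dot -sumEFin; apply: eq_bigr => i _.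
have [Ui EU] := Um i; rewrite integralZl//.
by move: EU; rewrite unlock => ->; rewrite -EFinM mulrC.
Qed.

(** Passes a pointwise bound, linear in [U] plus a multiple of its squared deviation, to
    expectations. The linear part is integrable by [has_mean], the square by the variance bound. *)
Lemma le_integral_quadratic (nrm : E -> R) (U : Xi -> E) m c p v B (S : Xi -> R)
    (a b : R) :
  is_norm nrm -> measurable_fun setT (U : Xi -> borel R k) -> has_mean Q U m ->
  ('E_Q[fun x => (dual_norm nrm (U x - c) ^+ 2)%R] <= B%:E)%E ->
  measurable_fun setT S -> (forall x, 0 <= S x) -> 0 <= b ->
  (forall x, S x <= a - dot (U x - p) v + b * dual_norm nrm (U x - c) ^+ 2) ->
  (\int[Q]_x (S x)%:E <= (a - dot (m - p) v + b * B)%:E)%E.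
Proof.
move=> hn mU Um; rewrite unlock => UB mS S0 b0 SU.
have [iU EU] := has_mean_dot v Um.
pose q x : R := dual_norm nrm (U x - c) ^+ 2.
have mq : measurable_fun setT q.
  apply: measurable_funX.
  apply: (@measurableT_comp _ _ _ _ _ _ (fun u : borel R k => dual_norm nrm ((u
    : E) - c)) _ U) => //.
  apply: continuous_borel_measurable => u.
  apply: (@continuous_comp _ _ _ (fun u : E => u - c) (dual_norm nrm));
    last exact: dual_norm_continuous.
  by apply: (@cvgB R _ _ (nbhs u) (nbhs_filter u) id (cst c) u c);
    [exact: cvg_id|exact: cvg_cst].
have iq : Q.-integrable setT (EFin \o q).
  apply/integrableP; split; first exact/measurable_EFinP.
  apply: le_lt_trans (ltry B); apply: le_trans UB.
  rewrite le_eqVlt; apply/orP; left; apply/eqP; apply: eq_integral => x _ /=.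
  by rewrite ger0_norm ?sqr_ge0.
have ia : Q.-integrable setT (EFin \o cst (a + dot p v)).
  by apply: finite_measure_integrable_cst.
apply: (@le_trans _ _ (\int[Q]_x ((a + dot p v)%:E - (dot (U x) v)%:E + b%:E *
  (q x)%:E))%E).
  apply: ge0_le_integral => //.
  - by move=> x _; rewrite lee_fin.
  - exact/measurable_EFinP.
  - apply: emeasurable_funD.
      by apply: emeasurable_funB => //; have /integrableP[] := iU.
    by apply: measurable_funeM; exact/measurable_EFinP.
  - move=> x _; rewrite -EFinB -EFinM -EFinD lee_fin (le_trans (SU x))//.
    by rewrite dotBl /q; lra.
rewrite integralD//; last 2 first.
- exact: integrableB.
- exact: (integrableZl measurableT).
rewrite integralB// integralZl// EU integral_cst//.
rewrite [X in (_ * X - _)%E](_ : _ = 1%E); last exact: probability_setT.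
rewrite mule1 -EFinB.
apply: (@le_trans _ _ ((a + dot p v - dot m v)%:E + b%:E * B%:E)%E).
  by rewrite leeD2l// lee_wpmul2l// lee_fin.
by rewrite -EFinM -EFinD lee_fin dotBl; lra.
Qed.

End random_vectors.

(** * One mirror descent step: the potential and its expected change *)

Section mirror_descent_step.
Context (R : realType) (k : nat) (d : measure_display).
Context (Xi : measurableType d) (Q : probability Xi R).
Notation E := 'rV[R]_k.
Variables (Z : set E) (r : E -> R) (nrm : E -> R).
Hypothesis Zconv : forall (t : R) x y, 0 <= t <= 1 -> Z x -> Z y ->
  Z (t *: x + (1 - t) *: y).
Hypothesis rconv : forall (t : R) x y, 0 <= t <= 1 -> Z x -> Z y ->
  r (t *: x + (1 - t) *: y) <= t * r x + (1 - t) * r y.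
Hypothesis r_ub : has_ubound (r @` Z).
Hypothesis three_point : bregman_three_point Z r.
Hypothesis hnrm : is_norm nrm.
Hypothesis r_sc : strongly_convex1 Z r nrm.
Notation D := (subdiff_dom Z r).
Notation V := (breg Z r).
Variables (alpha L eta : R).
Hypotheses (alpha0 : 0 < alpha) (L0 : 0 < L) (etaE : eta =
  alpha / (8 * L ^+ 2)).
Variables (g : E -> E) (gt : E -> E -> Xi -> E) (upd : E -> E -> Xi -> E).
Variables (w0 za : E).
Hypothesis g_mono : monotone_operator Z g.
Hypothesis gt_centered : forall z, Z z -> centered_estimator Q Z nrm g z L (gt
  z).
Hypothesis gt_meas : forall zc w, Z zc -> Z w ->
  measurable_fun setT (gt zc w : Xi -> borel R k).
Hypothesis za_prox : is_prox Z r alpha g w0 za.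
Hypothesis Dw0 : D w0.
Hypothesis upd_step : is_step_map Z r alpha eta w0 gt upd.

Lemma breg_ge_norm z u : D z -> Z u -> nrm (u - z) ^+ 2 <= 2 * V z u.
Proof.
move=> Dz Zu; have := r_sc.2 z u (subdiff_domW Dz) Zu.
by rewrite grad_pairingE// -!EFinD lee_fin /breg; lra.
Qed.

Let eta0 : 0 < eta.
Proof. by rewrite etaE divr_gt0// mulr_gt0// exprn_gt0. Qed.

(** This is what the choice of [eta] achieves: the variance term becomes alpha/16 |w - zc|^2, which
    [is_norm_sqrB] bounds by the alpha/8 terms of the potential. *)
Let etaL : eta / 2 * L ^+ 2 = alpha / 16.
Proof. by rewrite etaE; field; rewrite gt_eqF. Qed.

Lemma prox_subdiff_dom : D za.
Proof. exact: (prox_step Zconv rconv r_ub three_point alpha0 Dw0 za_prox).1.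
  Qed.

Lemma upd_subdiff_dom zc w x : Z zc -> D w -> D (upd zc w x).
Proof.
move=> Zzc Dw; have := upd_step x Zzc (subdiff_domW Dw).
by case/(argmin_step Zconv rconv r_ub three_point alpha0 eta0 Dw0 Dw).
Qed.

Definition md_potential (zc w : E) : R :=
  eta^-1 * V w za + dot (g zc - g za) (w - za) +
  alpha / 8 * (nrm (w - za) ^+ 2 + nrm (zc - za) ^+ 2).
Notation pot := md_potential.

Let nrmC u v : nrm (u - v) = nrm (v - u).
Proof. by rewrite -opprB is_normN. Qed.

(** Monotonicity handles <g(w) - g(za), w - za>. The remaining <g(zc) - g(w), w - za> is the
    expectation of <g(zc) - G, w - za>, with G the estimate at w; Young's inequality and the
    variance bound control it although g is not assumed Lipschitz. Young's bound is integrated with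
    [S] equal to 0. *)
Lemma md_potential_ge0 zc w : Z zc -> D w -> 0 <= pot zc w.
Proof.
move=> Zzc Dw; have Zw := subdiff_domW Dw; have Zza := subdiff_domW
  prox_subdiff_dom.
have [gmean gvar] := gt_centered Zzc Zw.
have : (\int[Q]_x (0 : R)%:E <= ((2 * eta)^-1 * nrm (w - za) ^+ 2
    - dot (g w - g zc) (w - za) + eta / 2 * (L ^+ 2 * nrm (w - zc) ^+ 2))%:E)%E.
  apply: (le_integral_quadratic hnrm (gt_meas Zzc Zw) gmean gvar) => //.
    by rewrite divr_ge0// ltW.
  move=> x; have := dot_young hnrm (gt zc w x - g zc) (w - za) eta0.
  by lra.
rewrite integral0 lee_fin mulrA etaL => h.
have nw : nrm (w - za) ^+ 2 <= 2 * V w za by rewrite nrmC breg_ge_norm.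
have mono := g_mono Zza Zw.
have := is_norm_sqrB hnrm w zc za.
have e2 : (2 * eta)^-1 = eta^-1 / 2 by rewrite invfM mulrC.
have := ler_wpM2l (_ : 0 <= eta^-1 / 2) nw.
rewrite divr_ge0 ?invr_ge0 ?(ltW eta0)// => /(_ isT).
move: h mono; rewrite e2 /pot !dotBl; move: eta^-1 => b.
move=> h mono h1 h2.
have := ler_wpM2l (ltW alpha0) h2.
lra.
Qed.

Lemma md_step_pointwise zc w x : D zc -> D w ->
  pot zc (upd zc w x) + alpha * V (upd zc w x) za <=
  eta^-1 * V w za + dot (g zc - g za) (w - za) + alpha / 4 * V zc za
  - dot (gt zc w x - g za) (w - za)
  + eta / 2 * dual_norm nrm (gt zc w x - g zc) ^+ 2.
Proof.
move=> Dzc Dw; have [Zzc Zw] := (subdiff_domW Dzc, subdiff_domW Dw).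
have Dza := prox_subdiff_dom; have Zza := subdiff_domW Dza.
set w' := upd zc w x; set G := gt zc w x.
have [Dw' step] := argmin_step Zconv rconv r_ub three_point alpha0 eta0 Dw0 Dw
  (upd_step x Zzc Zw).
(* In the sum of [s1] and [s2] the divergences from [w0] cancel, leaving -alpha V_w'(za) - alpha
   V_za(w') next to the 1/eta terms. *)
have {step}s1 := step za Zza; have Zw' := subdiff_domW Dw'.
have s2 := (prox_step Zconv rconv r_ub three_point alpha0 Dw0 za_prox).2 _ Zw'.
(* The quadratic term of Young's inequality is absorbed by V_w(w')/eta through [s4]. Through [s5]
   and [s6], the alpha/8 terms of the new potential cost at most alpha/4 V_za(w'), which is
   absorbed, and alpha/4 V_zc(za), which remains. *)
have s3 := dot_young hnrm (G - g zc) (w - w') eta0.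
have s4 := breg_ge_norm Dw Zw'.
have s5 := breg_ge_norm Dza Zw'.
have := breg_ge_norm Dzc Zza; rewrite nrmC => s6.
have e2 : (2 * eta)^-1 = eta^-1 / 2 by rewrite invfM mulrC.
have := ler_wpM2l (_ : 0 <= eta^-1 / 2) s4.
rewrite divr_ge0 ?invr_ge0 ?(ltW eta0)// => /(_ isT) {}s4.
have {}s5 := ler_wpM2l (ltW alpha0) s5.
have {}s6 := ler_wpM2l (ltW alpha0) s6.
have s7 : 0 <= alpha * V za w' by rewrite mulr_ge0 ?breg_ge0// ltW.
move: s1 s2 s3 s4 s5 s6 s7; rewrite e2 [nrm (w - w')]nrmC /pot -/w' -/G.
rewrite !dotBl !dotBr; move: eta^-1 => b.
lra.
Qed.

(** The second bound starts a phase: for w = zc the variance vanishes and the two terms <g(zc) -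
    g(za), zc - za> cancel, so only divergences remain and the initial potential does not appear. *)
Lemma md_step_integral zc w : D zc -> D w ->
  measurable_fun setT (fun x => pot zc (upd zc w x) + alpha * V (upd zc w x)
    za) ->
  (\int[Q]_x (pot zc (upd zc w x) + alpha * V (upd zc w x) za)%:E <=
   (pot zc w + alpha / 4 * V zc za)%:E)%E /\
  (w = zc ->
    \int[Q]_x (pot zc (upd zc w x) + alpha * V (upd zc w x) za)%:E <=
    ((eta^-1 + alpha / 4) * V zc za)%:E)%E.
Proof.
move=> Dzc Dw mS; have [Zzc Zw] := (subdiff_domW Dzc, subdiff_domW Dw).
have Dza := prox_subdiff_dom; have Zza := subdiff_domW Dza.
have [gmean gvar] := gt_centered Zzc Zw.
have bound : (\int[Q]_x (pot zc (upd zc w x) + alpha * V (upd zc w x) za)%:E <=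
  (eta^-1 * V w za + dot (g zc - g za) (w - za) + alpha / 4 * V zc za
   - dot (g w - g za) (w - za) + eta / 2 * (L ^+ 2 * nrm (w - zc) ^+ 2))%:E)%E.
  apply: (le_integral_quadratic hnrm (gt_meas Zzc Zw) gmean gvar mS).
  - move=> x; have Dx := upd_subdiff_dom x Zzc Dw.
    by rewrite addr_ge0 ?md_potential_ge0// mulr_ge0 ?breg_ge0// ltW.
  - by rewrite divr_ge0// ltW.
  - by move=> x; exact: md_step_pointwise.
rewrite mulrA etaL in bound.
split; last first.
  move=> wzc; apply: le_trans bound _; rewrite lee_fin wzc.
  by rewrite subrr is_norm0// expr0n/= mulr0 addr0; lra.
apply: le_trans bound _; rewrite lee_fin /pot.
have mono := g_mono Zza Zw; have := is_norm_sqrB hnrm w zc za.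
by move=> /(ler_wpM2l (ltW alpha0)); lra.
Qed.

End mirror_descent_step.

(** * Borel versions of the divergence and of the potential *)

Section measurability_of_the_divergence.
Context (R : realType) (k : nat).
Notation E := 'rV[R]_k.
Variables (Z : set E) (r : E -> R) (nrm : E -> R).
Hypothesis mZ : measurable (Z : set (borel R k)).
Hypothesis Zconv : forall (t : R) x y, 0 <= t <= 1 -> Z x -> Z y ->
  Z (t *: x + (1 - t) *: y).
Hypothesis three_point : bregman_three_point Z r.
Hypothesis r_meas : measurable_fun (Z : set (borel R k)) r.
Hypothesis hnrm : is_norm nrm.
Notation D := (subdiff_dom Z r).
Notation V := (breg Z r).
Variables (za : E) (g : E -> E).
Hypothesis Zza : Z za.
Hypothesis g_cont : {within Z, continuous g}.

Lemma continuous_borel (h : E -> E) : continuous h ->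
  measurable_fun setT (h : borel R k -> borel R k).
Proof.
move=> ch; apply: (measurability (@open E : set (set (borel R k)))) => //.
move=> _ [U oU <-]; rewrite setTI; apply: sub_sigma_algebra.
by apply: open_comp => // x _; exact: ch.
Qed.

Let rT : borel R k -> R := r \_ Z.

Let rT_meas : measurable_fun setT rT.
Proof. exact/(measurable_restrictT _ mZ). Qed.

Let rTE z : Z z -> rT z = r z.
Proof. by move=> Zz; rewrite /rT patchE mem_set. Qed.

(** The slope at [w], a supremum over the subdifferential, is replaced by a difference quotient of
    step 1/(n+1) towards [za], which is Borel in [w]. [is_derive_dir_slope] gives convergence to the
    divergence on [D]. *)
Definition breg_quotient (n : nat) (w : E) : R :=
  rT za - rT w - n.+1%:R * (rT (w + n.+1%:R^-1 *: (za - w)) - rT w).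

(* A Borel function on the whole space which agrees with the divergence to
   [za] wherever [r] has a subgradient. *)
Definition breg_borel (w : borel R k) : \bar R :=
  maxe 0%E (limn_esup (fun n => (breg_quotient n w)%:E)).

Lemma breg_borel_ge0 w : (0 <= breg_borel w)%E.
Proof. by rewrite /breg_borel le_max lexx. Qed.

Lemma measurable_breg_borel : measurable_fun setT breg_borel.
Proof.
apply: measurable_maxe; first exact: measurable_cst.
apply: measurable_fun_limn_esup => n; apply/measurable_EFinP.
apply: measurable_funB.
  by apply: measurable_funB => //; exact: measurable_cst.
apply: measurable_funM; first exact: measurable_cst.
apply: measurable_funB => //.
apply: (measurableT_comp rT_meas).
apply: (@continuous_borel (fun w => w + n.+1%:R^-1 *: (za - w))).
have -> : (fun w : E => w + n.+1%:R^-1 *: (za - w)) =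
    (fun w : E => (1 - n.+1%:R^-1) *: w - (- (n.+1%:R^-1 *: za))).
  by apply/funext => w; apply/rowP => i; rewrite !mxE; ring.
move=> w; apply: (@cvgB R _ _ (nbhs w) (nbhs_filter w)); last exact: cvg_cst.
exact: scaler_continuous.
Qed.

Lemma breg_borelE w : D w -> breg_borel w = (V w za)%:E.
Proof.
move=> Dw; have Zw := subdiff_domW Dw.
suff lim : (breg_quotient n w)%:E @[n --> \oo] --> (V w za)%:E.
  by rewrite /breg_borel (cvg_limn_einf_sup lim) max_r// lee_fin breg_ge0.
apply: cvg_EFin; first exact: nearW.
have /cvg_at_rightP/(_ harmonic) := is_derive_dir_slope Zconv three_point Dw
  Zza.
move=> /(_ (conj _ cvg_harmonic)) h.
have {}h := h (fun n => harmonic_gt0 n).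
apply: cvg_trans (cvgB (cvg_cst (r za - r w)) h).
apply: near_eq_cvg; apply: nearW => n /=.
rewrite /breg_quotient !fctE /= !rTE//.
  by rewrite invrK mulrC.
have -> : w + n.+1%:R^-1 *: (za - w) = n.+1%:R^-1 *: za + (1 - n.+1%:R^-1) *: w.
  by apply/rowP => i; rewrite !mxE; ring.
by apply: Zconv => //; rewrite invr_ge0 ler0n/= invf_le1// ler1n.
Qed.

Variables (alpha eta : R).
Hypothesis eta0 : 0 < eta.
Notation pot := (md_potential Z r nrm alpha eta g za).

Let gT i : borel R k -> R := (fun z => g z 0 i) \_ Z.

Let gT_meas i : measurable_fun setT (gT i).
Proof.
apply/(measurable_restrictT _ mZ); apply: within_continuous_borel_measurable =>
  //.
move=> z; apply: (@continuous_comp (subspace Z) E R g (fun v => v 0 i)).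
  exact: g_cont.
exact: coord_continuous.
Qed.

(** Truncated at 0 so as to be nonnegative on the whole product space, as Tonelli's theorem
    requires; where [md_potential_ge0] applies, the truncation changes nothing. *)
Definition md_potential_borel (p : borel R k * borel R k) : \bar R :=
  maxe 0%E ((eta^-1)%:E * breg_borel p.2 +
    (\sum_i (gT i p.1 - g za 0 i) * ((p.2 : E) 0 i - za 0 i) +
      alpha / 8 * (nrm ((p.2 : E) - za) ^+ 2 + nrm ((p.1 : E) - za) ^+
        2))%:E)%E.

Lemma md_potential_borel_ge0 p : (0 <= md_potential_borel p)%E.
Proof. by rewrite /md_potential_borel le_max lexx. Qed.

Lemma measurable_md_potential_borel : measurable_fun setT md_potential_borel.
Proof.
have mn : measurable_fun setT (fun w : borel R k => nrm ((w : E) - za)).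
  apply: continuous_borel_measurable => u.
  apply: (@continuous_comp _ _ _ (fun u : E => u - za) nrm);
    last exact: is_norm_continuous.
  by apply: (@cvgB R _ _ (nbhs u) (nbhs_filter u) id (cst za) u za);
    [exact: cvg_id|exact: cvg_cst].
have mc i : measurable_fun setT (fun w : borel R k => (w : E) 0 i).
  by apply: continuous_borel_measurable; exact: coord_continuous.
apply: measurable_maxe; first exact: measurable_cst.
apply: emeasurable_funD.
  apply: measurable_funeM.
  by apply: measurableT_comp measurable_breg_borel _; exact: measurable_snd.
apply/measurable_EFinP; apply: measurable_funD.
  apply: measurable_sum => i; apply: measurable_funM; apply: measurable_funB.
  - by apply: measurableT_comp (gT_meas i) _; exact: measurable_fst.
  - exact: measurable_cst.
  - by apply: measurableT_comp (mc i) _; exact: measurable_snd.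
  - exact: measurable_cst.
apply: measurable_funM; first exact: measurable_cst.
apply: measurable_funD; apply: measurable_funX; apply: (measurableT_comp mn).
- exact: measurable_snd.
- exact: measurable_fst.
Qed.

Lemma md_potential_borelE zc w : Z zc -> D w -> 0 <= pot zc w ->
  md_potential_borel (zc, w) = (pot zc w)%:E.
Proof.
move=> Zzc Dw p0; rewrite /md_potential_borel /= breg_borelE//.
have -> : \sum_i (gT i zc - g za 0 i) * (w 0 i - za 0 i) =
  dot (g zc - g za) (w - za).
  by rewrite /dot; apply: eq_bigr => i _; rewrite /gT patchE mem_set// !mxE.
rewrite -EFinM -EFinD max_r; last by move: p0; rewrite lee_fin /md_potential;
  lra.
by congr (_%:E); rewrite /md_potential; ring.
Qed.

End measurability_of_the_divergence.

(** * Independence: from generating events to integrals *)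

Section independence.
Context (R : realType) (dO : measure_display) (Omega : measurableType dO).
Variable P : probability Omega R.

(** Dynkin's pi-lambda theorem: the events independent of [A] form a lambda-system. Measurability in
    [Omega] is carried along the induction. *)
Lemma independent_generated (C : set (set Omega)) (A : set Omega) :
  setI_closed C -> measurable A ->
  (forall B, C B -> measurable B /\ P (B `&` A) = P A * P B)%E ->
  forall B, <<s C >> B -> (measurable B /\ P (B `&` A) = P A * P B)%E.
Proof.
move=> CI mA CA; pose T := g_sigma_algebraType C.
apply: (@dynkin_induction _ T C (fun B : set Omega => measurable B /\ P (B `&`
  A) = P A * P B)%E) => //.
- by split; [exact: measurableT|rewrite setTI probability_setT mule1].
- move=> B _ [mB BA]; split; first exact: measurableC.
  have PA : P A = (P (B `&` A) + P (~` B `&` A))%E.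
    rewrite -measureU; last 3 first.
    + exact: measurableI.
    + by apply: measurableI => //; exact: measurableC.
    + by rewrite setIACA setICr set0I.
    by rewrite -setIUl setUCr setTI.
  rewrite probability_setC// muleBr ?fin_num_adde_defr ?fin_num_measure//.
  by rewrite mule1 -BA [in RHS]PA addeAC subee ?add0e// fin_num_measure//;
    exact: measurableI.
- move=> F mF tF FA; have mF' n : measurable (F n : set Omega) by have [] := FA
  n.
  split; first exact: bigcup_measurable.
  have -> : P (\bigcup_n F n `&` A) = (\sum_(n <oo) P (F n `&` A))%E.
    rewrite setI_bigcupl measure_semi_bigcup//.
    - by move=> n; exact: measurableI.
    - exact: trivIset_setIr.
    - by apply: bigcup_measurable => n _; exact: measurableI.
  have -> : P (\bigcup_n F n) = (\sum_(n <oo) P (F n))%E.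
    by rewrite measure_semi_bigcup//; exact: bigcup_measurable.
  rewrite -[P A]fineK ?fin_num_measure// -nneseriesZl//.
  apply: eq_eseriesr => n _; rewrite fineK ?fin_num_measure//.
  by have [] := FA n.
Qed.

Section mutual_independence.
Variables (I : eqType) (D : set I) (sigma : I -> set_system Omega).
Hypothesis indep : mutually_independent P D sigma.
Hypothesis sigma_meas : forall i A, D i -> sigma i A -> measurable A.
Hypothesis sigmaI : forall i, setI_closed (sigma i).
Hypothesis sigmaT : forall i, sigma i setT.
Variables (i : I) (J : seq I).
Hypotheses (iJ : uniq (i :: J)) (Di : D i) (DJ : forall j, j \in J -> D j).

(** A pi-system generating the joint sigma-algebra of the draws in [J]. *)
Definition cylinders : set (set Omega) :=
  [set B | exists2 A : I -> set Omega, forall j, j \in J -> sigma j (A j) &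
    B = \bigcap_(j in [set` J]) A j].

Lemma cylinder_base j A : j \in J -> sigma j A -> cylinders A.
Proof.
move=> jJ sA; exists (fun l => if l == j then A else setT) => [l lJ|].
  by case: eqP => [->//|_]; exact: sigmaT.
apply/seteqP; split=> [x Ax l _|x /(_ j jJ)]; last by rewrite eqxx.
by case: eqP.
Qed.

Lemma independent_rest A B : sigma i A -> <<s cylinders >> B ->
  (measurable B /\ P (B `&` A) = P A * P B)%E.
Proof.
move=> sA; apply: independent_generated; last 1 first.
- move=> _ [F sF ->].
  have mF j : j \in J -> measurable (F j).
    by move=> jJ; apply: (sigma_meas (DJ jJ)); exact: sF.
  have mB : measurable (\bigcap_(j in [set` J]) F j).
    have := @fin_bigcap_measurable _ _ I [set` J] F (finite_seq J).
    by apply => j; exact: mF.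
  split=> //.
  have /andP[niJ uJ] := iJ.
  (* Merging [A] into the family lets mutual independence be used twice, over [i :: J] and over [J],
     and the two products are compared. *)
  have FE : \bigcap_(j in [set` J]) F j `&` A =
      \bigcap_(j in [set` i :: J]) (if j == i then A else F j).
    apply/seteqP; split=> x.
      move=> [Fx Ax] j /=; rewrite inE; case: eqP => [//|_ /= jJ]; exact: Fx.
    move=> h; split=> [j jJ|]; last by have := h i (mem_head _ _); rewrite eqxx.
    have := h j; rewrite /= inE (_ : j == i = false) ?orbT; first by apply;
      rewrite jJ.
    by apply/negbTE; apply: contra niJ => /eqP <-.
  rewrite FE indep//; last first.
    move=> j; rewrite inE; case: eqP => [-> //|_ /= jJ]; split;
      [exact: DJ|exact: sF].
  rewrite big_cons eqxx EFinM fineK ?fin_num_measure//;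
    last exact: (sigma_meas Di).
  congr (_ * _)%E; rewrite (indep uJ); last by move=> j jJ; split;
    [exact: DJ|exact: sF].
  congr (_%:E); rewrite big_seq [RHS]big_seq; apply: eq_bigr => j jJ.
  by rewrite (_ : j == i = false)//; apply/negbTE; apply: contra niJ => /eqP <-.
- move=> _ _ [F sF ->] [G sG ->]; exists (fun j => F j `&` G j).
    by move=> j jJ; apply: sigmaI; [exact: sF|exact: sG].
  by rewrite bigcapI.
- exact: (sigma_meas Di).
Qed.

End mutual_independence.

(** The hypothesis on rectangles, which for S = [setT] says that [Y] has law [Q], identifies the
    joint law of [W] and [Y] with the product measure by uniqueness; Tonelli's theorem then splits
    the integral. *)
Lemma integral_independent (dA dB : measure_display) (A : measurableType dA)
    (B : measurableType dB) (Q : probability B R) (W : Omega -> A)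
    (Y : Omega -> B) (f : A * B -> \bar R) :
  measurable_fun setT W -> measurable_fun setT Y ->
  (forall S U, measurable S -> measurable U ->
    P (W @^-1` S `&` Y @^-1` U) = P (W @^-1` S) * Q U)%E ->
  measurable_fun setT f -> (forall p, 0 <= f p)%E ->
  (\int[P]_w f (W w, Y w) = \int[P]_w \int[Q]_y f (W w, y))%E.
Proof.
move=> mW mY WY mf f0.
pose X : {mfun Omega >-> A} := HB.pack W (isMeasurableFun.Build _ _ _ _ W mW).
have mWY : measurable_fun setT (fun w => (W w, Y w)) by exact:
  measurable_fun_pair.
pose XY : {mfun Omega >-> (A * B)%type} :=
  HB.pack (fun w => (W w, Y w)) (isMeasurableFun.Build _ _ _ _ (fun w => (W w,
    Y w)) mWY).
transitivity (\int[distribution P XY]_p f p)%E.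
  by rewrite ge0_integral_distribution.
transitivity (\int[(distribution P X \x Q)]_p f p)%E.
  apply: eq_measure_integral => S mS _.
  by apply/esym; apply: product_measure_unique.
rewrite fubini_tonelli1//.
rewrite ge0_integral_distribution//.
- exact: measurable_fun_fubini_tonelli_F.
- by move=> x; exact: integral_ge0.
Qed.

End independence.

(** * Measurability of the iterates as functions of the draws *)

Section measurability_of_the_iterates.
Context (R : realType) (k : nat) (d dO : measure_display).
Context (Xi : measurableType d) (Omega : measurableType dO).
Notation E := 'rV[R]_k.
Notation B := (borel R k).
Variables (Z : set E) (upd : E -> E -> Xi -> E).
Hypothesis updZ : forall zc w x, Z zc -> Z w -> Z (upd zc w x).
Hypothesis mZ : measurable (Z : set B).
Hypothesis upd_meas : measurable_fun (Z `*` Z `*` setT : set (B * B * Xi))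
  (fun p => upd p.1.1 p.1.2 p.2 : B).

(** The step map with a default value off its domain, so that it can be composed with measurable
    maps on whole spaces. *)
Definition upd_borel : B * B * Xi -> B :=
  (fun p => upd p.1.1 p.1.2 p.2 : B) \_ (Z `*` Z `*` setT).

Lemma measurable_upd_borel : measurable_fun setT upd_borel.
Proof.
have mD : measurable (Z `*` Z `*` setT : set (B * B * Xi)).
  by apply: measurableX => //; exact: measurableX.
exact/(measurable_restrictT _ mD).
Qed.

Lemma upd_borelE zc w x : Z zc -> Z w -> upd_borel (zc, w, x) = upd zc w x.
Proof. by move=> Zzc Zw; rewrite /upd_borel patchE mem_set. Qed.

Lemma phase_iterate_in zc x t : Z zc -> Z (phase_iterate upd zc x t).
Proof. by move=> Zzc; elim: t => //= t; exact: updZ. Qed.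

Lemma smd_output_in w0 tau x n : Z w0 -> Z (smd_output upd w0 tau x n).
Proof. by move=> Zw0; elim: n => //= n; exact: phase_iterate_in. Qed.

Lemma measurable_phase_iterate (zc : Omega -> B) (x : nat -> Omega -> Xi) t :
  (forall w, Z (zc w)) -> measurable_fun setT zc ->
  (forall s, (1 <= s <= t)%N -> measurable_fun setT (x s)) ->
  measurable_fun setT (fun w => phase_iterate upd (zc w) (x^~ w) t : B).
Proof.
move=> Zzc mzc; elim: t => [//|t IH] mx /=.
have -> : (fun w => upd (zc w) (phase_iterate upd (zc w) (x^~ w) t) (x t.+1 w))
  =
    upd_borel \o (fun w => (zc w, phase_iterate upd (zc w) (x^~ w) t, x t.+1
      w)).
  by apply/funext => w /=; rewrite upd_borelE//; exact: phase_iterate_in.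
apply: measurableT_comp measurable_upd_borel _.
apply: measurable_fun_pair; last by apply: mx; rewrite leqnn.
apply: measurable_fun_pair => //; apply: IH => s /andP[s1 st].
by apply: mx; rewrite s1 ltnW.
Qed.

Lemma measurable_smd_output w0 (T : nat) (tau : nat -> Omega -> nat)
    (x : nat -> nat -> Omega -> Xi) n : Z w0 ->
  (forall nu, (1 <= nu <= n)%N -> measurable_fun setT (tau nu)) ->
  (forall nu w, (1 <= nu <= n)%N -> (tau nu w <= T)%N) ->
  (forall nu t, (1 <= nu <= n)%N -> (1 <= t <= T)%N ->
    measurable_fun setT (x nu t)) ->
  measurable_fun setT
    (fun w => smd_output upd w0 (tau^~ w) (fun nu t => x nu t w) n : B).
Proof.
move=> Zw0; elim: n => [|n IH] mtau tauT mx /=; first exact: measurable_cst.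
have {}IH : measurable_fun setT
    (fun w => smd_output upd w0 (tau^~ w) (fun nu t => x nu t w) n : B).
  apply: IH => [nu|nu w|nu t] /andP[n1 nn].
  - by apply: mtau; rewrite n1 ltnW.
  - by apply: tauT; rewrite n1 ltnW.
  - by apply: mx; rewrite n1 ltnW.
have n1 : (1 <= n.+1 <= n.+1)%N by rewrite leqnn.
move=> _ U mU; rewrite setTI.
pose F t w : B := phase_iterate upd
  (smd_output upd w0 (tau^~ w) (fun nu t => x nu t w) n) (fun t => x n.+1 t w)
    t.
(* The random length takes values at most [T], so the event splits into finitely many with a fixed
   length. *)
have -> : (fun w => F (tau n.+1 w) w) @^-1` U =
    \bigcup_(t in [set t | (t <= T)%N]) (tau n.+1 @^-1` [set t] `&` F t @^-1`
      U).
  apply/seteqP; split=> w /=; last by move=> [t _ [<-]].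
  by move=> FU; exists (tau n.+1 w) => //=; exact: tauT.
apply: bigcup_measurable => t /= tT; apply: measurableI.
  by rewrite -[X in measurable X]setTI; exact: mtau.
rewrite -[X in measurable X]setTI.
apply: measurable_phase_iterate => // [w|s /andP[s1 st]];
  first exact: smd_output_in.
by apply: mx => //; rewrite s1 (leq_trans st).
Qed.

End measurability_of_the_iterates.

(** * Each draw is independent of all the others together *)

Section draws.
Context (R : realType) (dO d : measure_display) (Omega : measurableType dO).
Context (Xi : measurableType d) (P : probability Omega R) (Q : probability Xi
  R).
Variables (N T : nat) (tau : nat -> Omega -> nat) (xi : nat -> nat -> Omega ->
  Xi).
Hypothesis draws : fresh_draws P Q N T tau xi.
Notation sigma := (draw_events tau xi).

Definition other_draws (i : nat + nat * nat) : seq (nat + nat * nat) :=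
  undup [seq j <- [seq inl nu | nu <- iota 1 N] ++
    [seq inr (nu, t) | nu <- iota 1 N, t <- iota 1 T] | j != i].

Lemma mem_other_draws i j : (j \in other_draws i) =
  (j \in draw_domain N T) && (j != i).
Proof.
rewrite /other_draws mem_undup mem_filter andbC mem_cat; congr (_ && _).
case: j => [nu|[nu t]].
  rewrite mem_map; last by move=> ? ? [].
  rewrite mem_iota add1n ltnS orbC (_ : _ \in [seq _ | _ <- _, _ <- _] =
    false)/=.
    by apply/idP/idP; rewrite inE.
  by apply/negbTE/negP => /allpairsP[[a b] [_ _]].
rewrite (_ : _ \in map _ _ = false)/=; last by apply/negbTE/negP => /mapP[].
apply/allpairsP/idP.
  move=> [[a b] /= [+ + [-> ->]]]; rewrite !mem_iota !add1n !ltnS inE => h1 h2.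
  exact/andP.
rewrite inE => /andP[h1 h2]; exists (nu, t) => /=.
by rewrite !mem_iota !add1n !ltnS.
Qed.

(* [Omega] with the sigma-algebra generated by all draws but [i] *)
Notation rest i := (g_sigma_algebraType (cylinders sigma (other_draws i))).

Let sigmaI i : setI_closed (sigma i).
Proof.
case: i => [nu|[nu t]] _ _ [U mU <-] [U' mU' <-]; exists (U `&` U').
- exact: measurableI.
- by rewrite !setTI.
- exact: measurableI.
- by rewrite !setTI.
Qed.

Let sigmaT i : sigma i setT.
Proof. by case: i => [nu|[nu t]]; exists setT => //; rewrite setTI. Qed.

Let sigma_meas i A : draw_domain N T i -> sigma i A -> measurable A.
Proof.
have [h1 h2 _] := draws.
case: i => [nu|[nu t]] /=.
  by move=> nuN [U mU <-]; have [mtau _ _] := h1 nu nuN; exact: mtau.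
by move=> /andP[nuN tT] [U mU <-]; have [mxi _] := h2 nu t nuN tT; exact: mxi.
Qed.

Lemma measurable_rest_tau i nu : (1 <= nu <= N)%N -> inl nu != i ->
  measurable_fun setT (tau nu : rest i -> nat).
Proof.
move=> nuN nui _ U mU; apply: sub_sigma_algebra.
apply: (@cylinder_base _ _ _ _ sigmaT _ (inl nu)); last by exists U.
by rewrite mem_other_draws nui andbT inE.
Qed.

Lemma measurable_rest_xi i nu t : (1 <= nu <= N)%N -> (1 <= t <= T)%N ->
  inr (nu, t) != i -> measurable_fun setT (xi nu t : rest i -> Xi).
Proof.
move=> nuN tT nui _ U mU; apply: sub_sigma_algebra.
apply: (@cylinder_base _ _ _ _ sigmaT _ (inr (nu, t))); last by exists U.
by rewrite mem_other_draws nui andbT inE /= nuN.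
Qed.

(** The form in which freshness is used: it is applied to the seed of a step against the current
    center and iterate, and to the length of a phase against its iterates. *)
Lemma draw_independent_rest i dA (A : measurableType dA) (W : Omega -> A) S H :
  draw_domain N T i -> measurable_fun setT (W : rest i -> A) -> measurable S ->
  sigma i H -> (P (W @^-1` S `&` H) = P (W @^-1` S) * P H)%E.
Proof.
move=> Di mW mS sH; rewrite muleC; have [_ _ indep] := draws.
have uniqJ : uniq (i :: other_draws i).
  by rewrite /= undup_uniq andbT mem_other_draws eqxx andbF.
have DJ j : j \in other_draws i -> draw_domain N T j.
  by rewrite mem_other_draws => /andP[+ _]; rewrite inE.
have mWS : <<s cylinders sigma (other_draws i) >> (W @^-1` S).
  by rewrite -[W @^-1` S]setTI; exact: mW.
exact: (independent_rest indep sigma_meas sigmaI uniqJ Di DJ sH mWS).2.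
Qed.

End draws.

(** * Contraction of the expected divergence over the phases *)

Section restarted_phases.
Context (R : realType) (k : nat) (d dO : measure_display).
Context (Xi : measurableType d) (Q : probability Xi R).
Context (Omega : measurableType dO) (P : probability Omega R).
Notation E := 'rV[R]_k.
Notation B := (borel R k).
Variables (Z : set E) (r : E -> R) (nrm : E -> R).
Hypothesis mZ : measurable (Z : set B).
Hypothesis Zconv : forall (t : R) x y, 0 <= t <= 1 -> Z x -> Z y ->
  Z (t *: x + (1 - t) *: y).
Hypothesis rconv : forall (t : R) x y, 0 <= t <= 1 -> Z x -> Z y ->
  r (t *: x + (1 - t) *: y) <= t * r x + (1 - t) * r y.
Hypothesis r_ub : has_ubound (r @` Z).
Hypothesis three_point : bregman_three_point Z r.
Hypothesis r_meas : measurable_fun (Z : set B) r.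
Hypothesis hnrm : is_norm nrm.
Hypothesis r_sc : strongly_convex1 Z r nrm.
Notation D := (subdiff_dom Z r).
Notation V := (breg Z r).
Variables (alpha L eta : R).
Hypotheses (alpha0 : 0 < alpha) (L0 : 0 < L) (etaE : eta =
  alpha / (8 * L ^+ 2)).
Variables (g : E -> E) (gt : E -> E -> Xi -> E) (upd : E -> E -> Xi -> E).
Variables (w0 za : E).
Hypothesis g_cont : {within Z, continuous g}.
Hypothesis g_mono : monotone_operator Z g.
Hypothesis gt_centered : forall z, Z z -> centered_estimator Q Z nrm g z L (gt
  z).
Hypothesis gt_meas : forall zc w, Z zc -> Z w ->
  measurable_fun setT (gt zc w : Xi -> B).
Hypothesis za_prox : is_prox Z r alpha g w0 za.
Hypothesis Dw0 : D w0.
Hypothesis upd_step : is_step_map Z r alpha eta w0 gt upd.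
Hypothesis upd_meas : measurable_fun (Z `*` Z `*` setT : set (B * B * Xi))
  (fun p => upd p.1.1 p.1.2 p.2 : B).
Variables (N T : nat) (tau : nat -> Omega -> nat) (xi : nat -> nat -> Omega ->
  Xi).
Hypothesis draws : fresh_draws P Q N T tau xi.
Hypothesis T_ge : 4 / (eta * alpha) <= T%:R.

Notation pot := (md_potential Z r nrm alpha eta g za).
Notation potB := (md_potential_borel Z r nrm za g alpha eta).
Notation phi := (breg_borel Z r za).
Notation updB := (upd_borel Z upd).
Let out n (w : Omega) : B :=
  smd_output upd w0 (tau^~ w) (fun nu t => xi nu t w) n.

Let eta0 : 0 < eta.
Proof. by rewrite etaE divr_gt0// mulr_gt0// exprn_gt0. Qed.

Let Dza : D za.
Proof. exact: (prox_subdiff_dom Zconv rconv r_ub three_point alpha0 za_prox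
  Dw0). Qed.

Let Zza := subdiff_domW Dza.
Let Zw0 := subdiff_domW Dw0.

Let updD zc w x : Z zc -> D w -> D (upd zc w x).
Proof. exact: (upd_subdiff_dom Zconv rconv r_ub three_point alpha0 L0 etaE Dw0
  upd_step). Qed.

Let updZ zc w x : Z zc -> Z w -> Z (upd zc w x).
Proof. by move=> Zzc Zw; have [] := upd_step x Zzc Zw. Qed.

Let iterD zc x t : D zc -> D (phase_iterate upd zc x t).
Proof.
move=> Dzc; elim: t => [|t IH] /=; first exact: Dzc.
by apply: updD => //; exact: subdiff_domW Dzc.
Qed.

Lemma smd_output_subdiff_dom n w : D (out n w).
Proof. by rewrite /out; elim: n => [|n IH] /=; [exact: Dw0|exact: iterD]. Qed.

Let phiE w : D w -> phi w = (V w za)%:E.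
Proof. exact: breg_borelE. Qed.

Let mphi : measurable_fun setT phi.
Proof. exact: measurable_breg_borel. Qed.

Let phi0 w : (0 <= phi w)%E.
Proof. exact: breg_borel_ge0. Qed.

Let mpotB : measurable_fun setT potB.
Proof. exact: measurable_md_potential_borel. Qed.

Let potB0 p : (0 <= potB p)%E.
Proof. exact: md_potential_borel_ge0. Qed.

Let pot0 zc w : Z zc -> D w -> 0 <= pot zc w.
Proof.
exact: (md_potential_ge0 Zconv rconv r_ub three_point hnrm r_sc alpha0 L0 etaE
  g_mono gt_centered gt_meas za_prox Dw0).
Qed.

Let potBE zc w : Z zc -> D w -> potB (zc, w) = (pot zc w)%:E.
Proof. by move=> Zzc Dw; apply: md_potential_borelE => //; exact: pot0. Qed.

Let mupdB : measurable_fun setT updB.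
Proof. exact: measurable_upd_borel. Qed.

(** The quantity bounded by one step, as a nonnegative measurable function of center, iterate and
    seed on the whole space. *)
Let after (p : B * B * Xi) : \bar R :=
  (potB (p.1.1, updB p) + alpha%:E * phi (updB p))%E.

Let mafter : measurable_fun setT after.
Proof.
apply: emeasurable_funD.
  apply: (measurableT_comp mpotB); apply: measurable_fun_pair => //.
  by apply: measurableT_comp => //; exact: measurable_fst.
by apply: measurable_funeM; exact: measurableT_comp.
Qed.

Let after0 p : (0 <= after p)%E.
Proof. by rewrite /after adde_ge0// mule_ge0// lee_fin ltW. Qed.

Let afterE zc w x : D zc -> D w ->
  after (zc, w, x) = (pot zc (upd zc w x) + alpha * V (upd zc w x) za)%:E.
Proof.
move=> Dzc Dw; have [Zzc Zw] := (subdiff_domW Dzc, subdiff_domW Dw).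
have Du := updD x Zzc Dw.
by rewrite /after/= (@upd_borelE _ _ _ _ Z upd zc w x Zzc Zw) potBE// phiE//
  -EFinM -EFinD.
Qed.

Let integral_after zc w : D zc -> D w ->
  (\int[Q]_x after (zc, w, x) <= potB (zc, w) + (alpha / 4)%:E * phi zc)%E /\
  (w = zc -> \int[Q]_x after (zc, w, x) <= (eta^-1 + alpha / 4)%:E * phi zc)%E.
Proof.
move=> Dzc Dw; have Zzc := subdiff_domW Dzc.
rewrite potBE// phiE// -!EFinM -EFinD.
under eq_integral do rewrite afterE//.
apply: (md_step_integral Zconv rconv r_ub three_point hnrm r_sc alpha0 L0 etaE
  g_mono gt_centered gt_meas za_prox Dw0 upd_step) => //.
apply/measurable_EFinP.
have -> : EFin \o (fun x => pot zc (upd zc w x) + alpha * V (upd zc w x) za) =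
    (fun x => after (zc, w, x)).
  by apply/funext => x /=; rewrite afterE.
exact: measurable_fun_pair2 mafter.
Qed.

Section one_phase.
Variable n : nat.
Hypothesis nN : (n < N)%N.

Let zc := out n.
(** The trajectory up to step [T], whether or not the drawn length stops it earlier; it thus does
    not depend on the length of its phase. *)
Let iter t (w : Omega) : B := phase_iterate upd (zc w) (fun s => xi n.+1 s w) t.

Let Dzc w : D (zc w). Proof. exact: smd_output_subdiff_dom. Qed.
Let Diter t w : D (iter t w). Proof. exact: iterD. Qed.

Let n1N : (1 <= n.+1 <= N)%N. Proof. exact: nN. Qed.

Let phaseN nu : (1 <= nu <= n)%N -> (1 <= nu <= N)%N.
Proof. by move=> /andP[-> h]; exact: leq_trans h (ltnW nN). Qed.

(** The center depends only on draws of the first [n] phases, so it is measurable for the draws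
    other than [i] when [i] is none of these. *)
Let mzc_rest i : (forall nu, (1 <= nu <= n)%N -> inl nu != i) ->
  (forall nu t, (1 <= nu <= n)%N -> inr (nu, t) != i) ->
  measurable_fun setT
    (zc : g_sigma_algebraType (cylinders (draw_events tau xi) (other_draws N T
      i)) -> B).
Proof.
move=> h1 h2; have [ht _ _] := draws.
apply: (@measurable_smd_output _ _ _ _ _ _ Z _ _ _ _ w0 T) => // [nu nun|nu w
  nun|nu t nun tT].
- by apply: measurable_rest_tau => //; [exact: phaseN|exact: h1].
- by have [_ /(_ w)/andP[]] := ht nu (phaseN nun).
- by apply: measurable_rest_xi => //; [exact: phaseN|exact: h2].
Qed.

Let miter_rest i t : (forall nu, (1 <= nu <= n)%N -> inl nu != i) ->
  (forall nu t, (1 <= nu <= n)%N -> inr (nu, t) != i) ->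
  (t <= T)%N -> (forall s, (1 <= s <= t)%N -> inr (n.+1, s) != i) ->
  measurable_fun setT
    (iter t : g_sigma_algebraType (cylinders (draw_events tau xi) (other_draws
      N T i)) -> B).
Proof.
move=> h1 h2 tT h3; apply: (@measurable_phase_iterate _ _ _ _ _ _ Z) => //.
- by move=> w; exact: subdiff_domW (Dzc w).
- exact: mzc_rest.
- move=> s /andP[s1 st]; apply: measurable_rest_xi => //.
    by rewrite s1 (leq_trans st).
  by apply: h3; rewrite s1.
Qed.

Let mzc : measurable_fun setT (zc : Omega -> B).
Proof.
have [ht hx _] := draws.
apply: (@measurable_smd_output _ _ _ _ _ _ Z _ _ _ _ w0 T) => // [nu nun|nu w
  nun|nu t nun tT].
- by have [] := ht nu (phaseN nun).
- by have [_ /(_ w)/andP[]] := ht nu (phaseN nun).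
- by have [] := hx nu t (phaseN nun) tT.
Qed.

Let miter t : (t <= T)%N -> measurable_fun setT (iter t : Omega -> B).
Proof.
have [_ hx _] := draws.
move=> tT; apply: (@measurable_phase_iterate _ _ _ _ _ _ Z) => //.
- by move=> w; exact: subdiff_domW (Dzc w).
- move=> s /andP[s1 st]; have sT : (1 <= s <= T)%N by rewrite s1 (leq_trans st).
  by have [] := hx n.+1 s n1N sT.
Qed.

(** Expectations of nonnegative functions, a priori possibly infinite; the bounds below are stated
    in the extended reals. *)
Let e t := (\int[P]_w potB (zc w, iter t w))%E.
Let dv t := (\int[P]_w phi (iter t w))%E.
Let d0 := (\int[P]_w phi (zc w))%E.

Let d0_ge0 : (0 <= d0)%E.
Proof. by apply: integral_ge0 => w _; exact: phi0. Qed.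

Let dv_ge0 t : (0 <= dv t)%E.
Proof. by apply: integral_ge0 => w _; exact: phi0. Qed.

Let e_ge0 t : (0 <= e t)%E.
Proof. by apply: integral_ge0 => w _; exact: potB0. Qed.

Let mphi_iter t : (t <= T)%N -> measurable_fun setT (fun w => phi (iter t w)).
Proof. by move=> tT; apply: measurableT_comp => //; exact: miter. Qed.

Let mphi_zc : measurable_fun setT (fun w => phi (zc w)).
Proof. exact: measurableT_comp. Qed.

Let mpotB_iter t : (t <= T)%N -> measurable_fun setT (fun w => potB (zc w, iter
  t w)).
Proof.
move=> tT; apply: (measurableT_comp mpotB); apply: measurable_fun_pair => //.
exact: miter.
Qed.

(** The seed of step t + 1 is independent of the center and of iterate t, so it can be integrated
    out first. *)
Let integral_step t : (t < T)%N -> (e t.+1 + alpha%:E * dv t.+1 =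
  \int[P]_w \int[Q]_x after (zc w, iter t w, x))%E.
Proof.
move=> tT; have [_ hx _] := draws.
have tT1 : (1 <= t.+1 <= T)%N by [].
have [mxi xiQ] := hx n.+1 t.+1 n1N tT1.
pose W w : B * B := (zc w, iter t w).
have mW : measurable_fun setT W.
  by apply: measurable_fun_pair => //; apply: miter; exact: ltnW.
rewrite -(@integral_independent _ _ _ P _ _ _ _ Q W (xi n.+1 t.+1) after) //.
- have Ei w : after (W w, xi n.+1 t.+1 w) =
      (potB (zc w, iter t.+1 w) + alpha%:E * phi (iter t.+1 w))%E.
    rewrite /after /= (@upd_borelE _ _ _ _ Z upd)//.
    + exact: subdiff_domW (Dzc w).
    + exact: subdiff_domW (Diter t w).
  under eq_integral do rewrite Ei.
  rewrite ge0_integralD//.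
  + rewrite ge0_integralZl//.
    * exact: mphi_iter.
    * by rewrite lee_fin ltW.
  + exact: mpotB_iter.
  + by move=> w _; rewrite mule_ge0// lee_fin ltW.
  + by apply: measurable_funeM; exact: mphi_iter.
- move=> S U mS mU; rewrite -xiQ//.
  apply: (draw_independent_rest draws (i := inr (n.+1, t.+1)) (A := (B *
    B)%type)) => //.
  + by apply/andP.
  + apply: measurable_fun_pair.
      apply: mzc_rest => // nu s /andP[_ nun]; apply/eqP => -[nuE _].
      by rewrite nuE ltnn in nun.
    apply: miter_rest => //; last first.
    * move=> s /andP[_ st]; apply/eqP => -[sE].
      by rewrite sE ltnn in st.
    * exact: ltnW.
    * move=> nu s /andP[_ nun]; apply/eqP => -[nuE _].
      by rewrite nuE ltnn in nun.
  + by exists U => //; rewrite setTI.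
Qed.

Let mafter_int : measurable_fun setT (fun p : B * B => \int[Q]_x after (p,
  x))%E.
Proof. exact: measurable_fun_fubini_tonelli_F. Qed.

Let step0 : (0 < T)%N ->
  (e 1 + alpha%:E * dv 1 <= (eta^-1 + alpha / 4)%:E * d0)%E.
Proof.
move=> T0; rewrite integral_step// /d0 -ge0_integralZl//; last first.
  by rewrite lee_fin addr_ge0 ?invr_ge0 ?divr_ge0// ltW.
apply: ge0_le_integral => //.
- by move=> w _; apply: integral_ge0 => x _; exact: after0.
- apply: (measurableT_comp mafter_int); exact: measurable_fun_pair.
- exact: measurable_funeM.
- by move=> w _; apply: (integral_after (Dzc w) (Diter 0 w)).2.
Qed.

Let stepS t : (t < T)%N ->
  (e t.+1 + alpha%:E * dv t.+1 <= e t + (alpha / 4)%:E * d0)%E.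
Proof.
move=> tT; rewrite integral_step// /d0 -ge0_integralZl//; last first.
  by rewrite lee_fin divr_ge0// ltW.
have tT' := ltnW tT; rewrite /e -ge0_integralD//; last 3 first.
- exact: mpotB_iter.
- by move=> w _; rewrite mule_ge0// lee_fin divr_ge0// ltW.
- exact: measurable_funeM.
apply: ge0_le_integral => //.
- by move=> w _; apply: integral_ge0 => x _; exact: after0.
- apply: (measurableT_comp mafter_int); apply: measurable_fun_pair => //.
  exact: miter.
- by apply: emeasurable_funD; [exact: mpotB_iter|exact: measurable_funeM].
- by move=> w _; apply: (integral_after (Dzc w) (Diter t w)).1.
Qed.

(** The potentials telescope. The first step costs (1/eta + alpha/4) d0 by [step0], each later one
    alpha/4 d0 by [stepS]; the divergences summed are those after steps 1 to t + 1. *)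
Let sum_bound t : (t < T)%N ->
  (e t.+1 + alpha%:E * \sum_(0 <= s < t.+1) dv s.+1 <=
   (eta^-1 + t.+1%:R * (alpha / 4))%:E * d0)%E.
Proof.
elim: t => [T0|t IH tT]; first by rewrite big_nat1 mul1r step0.
have := IH (ltnW tT) => h.
rewrite big_nat_recr//= ge0_muleDr ?sume_ge0// addeCA.
rewrite addeC (le_trans (leeD (stepS tT) (lexx _)))//.
rewrite addeAC (le_trans (leeD h (lexx _)))//.
rewrite -ge0_muleDl ?lee_fin.
- by rewrite -EFinD lee_wpmul2r// lee_fin -[t.+2%:R]natr1; lra.
- by rewrite addr_ge0 ?invr_ge0 ?mulr_ge0 ?divr_ge0// ltW.
- by rewrite divr_ge0// ltW.
Qed.

Let T0 : (0 < T)%N.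
Proof.
have : 0 < T%:R :> R by apply: lt_le_trans T_ge; rewrite divr_gt0// mulr_gt0.
by rewrite ltr0n.
Qed.

(** The output is split according to the drawn length, which is independent of the iterates and
    takes each value from 1 to [T] with probability 1/T. *)
Let integral_out :
  (\int[P]_w phi (out n.+1 w) = (T%:R^-1)%:E * \sum_(s < T) dv s.+1)%E.
Proof.
have [ht _ _] := draws; have [mtau tauT tauP] := ht n.+1 n1N.
pose X : {mfun Omega >-> nat} :=
  HB.pack (tau n.+1) (isMeasurableFun.Build _ _ _ _ (tau n.+1) mtau).
pose f t (p : B * nat) : \bar R := (phi p.1 * (\1_[set t] p.2)%:E)%E.
have m1 t : measurable_fun setT (\1_[set t] : nat ->
  R) by exact: measurable_indic.
have mf t : measurable_fun setT (f t).
  apply: emeasurable_funM; first by apply: measurableT_comp => //;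
    exact: measurable_fst.
  by apply/measurable_EFinP; exact: (measurableT_comp (m1 t) measurable_snd).
have f0 t p : (0 <= f t p)%E by rewrite /f mule_ge0// lee_fin.
have outE w : phi (out n.+1 w) = (\sum_(s < T) f s.+1 (iter s.+1 w, tau n.+1
  w))%E.
  (* Lengths are at least 1, which excludes the value 0 and matches the index shift [s.+1]. *)
  have := tauT w; case tE : (tau n.+1 w) => [//|t] /= tT.
  rewrite (bigD1 (Ordinal tT))//= big1 ?adde0.
    by rewrite /f /= indicE mem_set// mule1 /out /= tE.
  move=> s /eqP st; rewrite /f /= indicE memNset ?mule0//= => -[ts].
  by apply: st; exact: val_inj.
under eq_integral do rewrite outE.
have mpair (s : 'I_T) : measurable_fun setT (fun w => (iter s.+1 w, tau n.+1
  w)).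
  by apply: measurable_fun_pair => //; exact: miter.
rewrite ge0_integral_sum//; last by move=> s; exact: measurableT_comp (mf _)
  (mpair s).
rewrite ge0_sume_distrr//; apply: eq_bigr => s _.
have sT : (1 <= s.+1 <= T)%N by rewrite ltn_ord.
rewrite (@integral_independent _ _ _ P _ _ _ _ (distribution P X) (iter s.+1)
  (tau n.+1) (f s.+1))//.
- rewrite -ge0_integralZl//.
  + apply: eq_integral => w _; rewrite /f /= ge0_integralZl// integral_indic//.
    rewrite setIT muleC; congr (_ * _)%E.
    by rewrite -(tauP _ sT).
  + exact: mphi_iter.
- exact: miter.
- move=> S U mS mU.
  apply: (draw_independent_rest draws (i := inl n.+1)) => //.
  + apply: miter_rest => // nu /andP[_ nun]; apply/eqP => -[nuE].
    by rewrite nuE ltnn in nun.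
  + by exists U => //; rewrite setTI.
Qed.

Lemma phase_contraction :
  (\int[P]_w phi (out n.+1 w) <= (2^-1)%:E * \int[P]_w phi (out n w))%E.
Proof.
rewrite integral_out -/d0; have [t Tt] : exists t, T = t.+1 by exists T.-1;
  rewrite prednK.
have tT : (t < T)%N by rewrite Tt.
have := sum_bound tT; rewrite -Tt big_mkord => h.
have {}h : (alpha%:E * \sum_(s < T) dv s.+1 <= (eta^-1 + T%:R * (alpha / 4))%:E
  * d0)%E.
  (* The nonnegative potential after the last step is dropped. *)
  by apply: le_trans h; rewrite leeDr.
have Tr0 : 0 < T%:R :> R by rewrite ltr0n.
have -> : (T%:R^-1)%:E = (((T%:R * alpha)^-1)%:E * alpha%:E)%E.
  by rewrite -EFinM; congr (_%:E); field; rewrite !gt_eqF.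
rewrite -muleA; apply: (@le_trans _ _ (((T%:R * alpha)^-1)%:E *
    ((eta^-1 + T%:R * (alpha / 4))%:E * d0))%E).
  by rewrite lee_wpmul2l// lee_fin invr_ge0 mulr_ge0// ltW.
rewrite muleA -EFinM lee_wpmul2r// lee_fin mulrC ler_pdivrMr ?mulr_gt0//.
(* The lower bound on [T], in the form that makes 1/(eta alpha T) at most 1/4. *)
have : eta^-1 * 4 <= T%:R * alpha.
  by move: T_ge; rewrite invfM mulrA ler_pdivrMr// mulrC.
by lra.
Qed.

End one_phase.

Lemma smd_contraction n : (n <= N)%N ->
  (\int[P]_w phi (out n w) <= (2^-1 ^+ n)%:E * (V w0 za)%:E)%E.
Proof.
elim: n => [_|n IH nN].
  rewrite expr0 mul1e (eq_integral (cst (V w0 za)%:E)); last first.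
    by move=> w _ /=; rewrite phiE.
  by rewrite integral_cst// [X in (_ * X <= _)%E](_ : _ = 1%E) ?mule1//;
    exact: probability_setT.
rewrite (le_trans (phase_contraction nN))// exprS EFinM -muleA.
by rewrite lee_wpmul2l ?IH ?(ltnW nN)// lee_fin.
Qed.

End restarted_phases.

(** * Closedness of the product domain, and the bound on the expected divergence *)

(** Both projections only select coordinates, so they do not increase the sup norm and are
    continuous. Closedness serves to make the domain a Borel set. *)
Lemma closed_prod_domain (R : realType) (n m : nat) (X : set 'rV[R]_n)
    (Y : set 'rV[R]_m) : closed X -> closed Y -> closed (prod_domain X Y).
Proof.
have sub_cont p (h : 'rV[R]_(n + m) -> 'rV[R]_p) (s : 'I_p -> 'I_(n + m)) :
    (forall z i, h z 0 i = z 0 (s i)) -> continuous h.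
  move=> hs z; apply/(@cvgrPdist_lt _ _ _ (nbhs z) (nbhs_filter z)) => e e0.
  apply/nbhs_ballP; exists e => // v; rewrite -ball_normE /= => zv.
  apply: le_lt_trans zv; rewrite [leLHS]/Num.norm/= mx_normrE.
  apply/bigmax_leP; split=> //= -[i j] _ /=; rewrite ord1 !mxE !hs.
  by have := coord_le_norm (z - v) (s j); rewrite !mxE.
move=> cX cY; rewrite (_ : prod_domain X Y = lsubmx @^-1` X `&` rsubmx @^-1`
  Y)//.
apply: closedI; apply: preimage_closed => // z _.
- by apply: (sub_cont _ _ (lshift m)) => {}z i; rewrite mxE.
- by apply: (sub_cont _ _ (@rshift n m)) => {}z i; rewrite mxE.
Qed.

Theorem proposition4 (R : realType) (n m : nat)
  (X : set 'rV[R]_n) (Y : set 'rV[R]_m)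
  (hXconv : convex_set X) (hXcomp : compact X)
  (hYconv : convex_set Y) (hYcomp : compact Y)
  (Z : set 'rV[R]_(n + m)) (hZ : Z = prod_domain X Y)
  (nrm : 'rV[R]_(n + m) -> R) (hnrm : is_norm nrm)
  (r : 'rV[R]_(n + m) -> R)
  (hr_sc : strongly_convex1 Z r nrm)
  (hr_bounded : has_ubound (r @` Z) /\ has_lbound (r @` Z))
  (hr_meas : measurable_fun (Z : set (borel R (n + m))) r)
  (hr_three_point : bregman_three_point Z r)
  (alpha L : R) (halpha : 0 < alpha) (hL : 0 < L)
  (w0 : 'rV[R]_(n + m)) (hw0 : Z w0)
  (g : 'rV[R]_(n + m) -> 'rV[R]_(n + m))
  (hg_cont : {within Z, continuous g})
  (hg_mono : monotone_operator Z g)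
  (dXi : measure_display) (Xi : measurableType dXi) (Q : probability Xi R)
  (gt : 'rV[R]_(n + m) -> 'rV[R]_(n + m) -> Xi -> 'rV[R]_(n + m))
  (hgt_meas : measurable_fun
     (Z `*` Z `*` setT : set (borel R (n + m) * borel R (n + m) * Xi))
     (fun p => gt p.1.1 p.1.2 p.2 : borel R (n + m)))
  (hgt : forall z0, Z z0 -> centered_estimator Q Z nrm g z0 L (gt z0))
  (zalpha : 'rV[R]_(n + m)) (hzalpha : is_prox Z r alpha g w0 zalpha)
  (eta : R) (heta : eta = alpha / (8 * L ^+ 2))
  (T : nat) (hT : 4 / (eta * alpha) <= T%:R) (N : nat)
  (upd : 'rV[R]_(n + m) -> 'rV[R]_(n + m) -> Xi -> 'rV[R]_(n + m))
  (hupd : is_step_map Z r alpha eta w0 gt upd)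
  (hupd_meas : measurable_fun
     (Z `*` Z `*` setT : set (borel R (n + m) * borel R (n + m) * Xi))
     (fun p => upd p.1.1 p.1.2 p.2 : borel R (n + m)))
  (dO : measure_display) (Omega : measurableType dO) (P : probability Omega R)
  (tau : nat -> Omega -> nat) (xi : nat -> nat -> Omega -> Xi)
  (hdraws : fresh_draws P Q N T tau xi) :
  (\int[P]_omega bregman Z r
      (smd_output upd w0 (tau^~ omega) (fun nu t => xi nu t omega) N) zalpha
    <= (2^-1 ^+ N)%:E * bregman Z r w0 zalpha)%E.
Proof.
have cX : closed X by apply: compact_closed hXcomp; exact: norm_hausdorff.
have cY : closed Y by apply: compact_closed hYcomp; exact: norm_hausdorff.
have mZ : measurable (Z : set (borel R (n + m))).
  have : closed Z by rewrite hZ; exact: closed_prod_domain.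
  move=> /closed_openC oZ; rewrite -[Z]setCK; apply: measurableC.
  exact: sub_sigma_algebra.
have Zconv (t : R) x y : 0 <= t <= 1 -> Z x -> Z y -> Z (t *: x + (1 - t) *: y).
  rewrite hZ => t01 [Xx Yx] [Xy Yy]; split; rewrite linearP linearZ/=.
  - exact: convex_setP.
  - exact: convex_setP.
have rconv := convex_functionP hr_sc.1.
have gt_meas zc w : Z zc -> Z w ->
    measurable_fun setT (gt zc w : Xi -> borel R (n + m)).
  move=> Zzc Zw.
  have mD : measurable (Z `*` Z `*` setT : set (borel R (n + m) * borel R (n +
    m) * Xi)).
    by apply: measurableX => //; exact: measurableX.
  have mp : measurable_fun setT
      (fun x : Xi => ((zc, w, x) : borel R (n + m) * borel R (n + m) * Xi)).
    by apply: measurable_fun_pair => //; exact: measurable_cst.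
  have pD : [set (zc, w, x) | x in setT] `<=` Z `*` Z `*` [set: Xi].
    by move=> _ [x _ <-].
  exact: (measurable_comp mD pD hgt_meas mp).
have [Dw0|nDw0] := pselect (subdiff_dom Z r w0); last first.
  by rewrite bregman_notin// gt0_muley ?leey// lte_fin exprn_gt0.
have Zza := hzalpha.1; rewrite bregmanE//.
apply: le_trans (smd_contraction mZ Zconv rconv hr_bounded.1 hr_three_point
  hr_meas hnrm
  hr_sc halpha hL heta hg_cont hg_mono hgt gt_meas hzalpha Dw0 hupd hupd_meas
  hdraws hT (leqnn N)).
(* The outputs stay in [D], where the extended divergence and its Borel version agree, so the two
   integrals are equal. *)
rewrite le_eqVlt; apply/orP; left; apply/eqP; apply: eq_integral => w _.
have Dout := smd_output_subdiff_dom Zconv rconv hr_bounded.1 hr_three_point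
  halpha hL heta Dw0 hupd tau xi N w.
by rewrite bregmanE// breg_borelE.
Qed.
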